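(* Any two non-c-archimedean c-regular discrete abelian cyclically ordered groups are elementarily equivalent (in the language of cyclically ordered groups) if and only if they satisfy the same formulas $D_{p^n,k}$ ($p$ prime, $n\in\mathbb{N}^*$, $k\in\{0,\dots,p^n-1\}$).
   Context: All groups are abelian, written additively; $\mathbb{N}^*$ is the set of positive integers. A cyclically ordered group $(G,R)$ is an abelian group $G$ with a ternary relation $R$ such that: $R(a,b,c)$ implies that $a,b,c$ are pairwise distinct; $R(a,b,c)\Rightarrow R(b,c,a)$; for every $c\in G$, $R(c,\cdot,\cdot)$ is a strict linear order on $G\setminus\{c\}$; $R(a,b,c)\Rightarrow R(a+u,b+u,c+u)$. The language of cyclically ordered groups is the language of groups together with $R$. $G$ is discrete if it is trivial or $G\setminus\{0\}$ has a smallest element for the order $R(0,\cdot,\cdot)$; in the nontrivial case this smallest element is denoted $1_G$ (it is definable). $\mathbb{K}$ is the group of complex numbers of modulus $1$, cyclically ordered by: for $0\le\theta_1,\theta_2,\theta_3<2\pi$, $R(e^{i\theta_1},e^{i\theta_2},e^{i\theta_3})$ iff $\theta_1<\theta_2<\theta_3$ up to cyclic permutation of the indices. $G$ is c-archimedean if it is isomorphic, as a cyclically ordered group, to a subgroup of $\mathbb{K}$. $R(x_1,\dots,x_m)$ (with $m\ge3$) means that $R(x_i,x_j,x_k)$ holds for all $1\le i<j<k\le m$; $R(x_1,x_2)$ means $x_1\ne x_2$. For $n\ge2$, $(G,R)$ is c-$n$-regular if for all $x_1,\dots,x_n\in G$ with $R(0,x_1,\dots,x_n)$ there is $x\in G$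 such that ($nx=x_1$ or $nx=x_n$ or $R(x_1,nx,x_n)$) and $R(0,x,\dots,(n-1)x,x_n)$. $G$ is c-regular if it is c-$n$-regular for every $n\ge2$. For $G$ discrete and not c-archimedean, $p$ prime, $n\in\mathbb{N}^*$ and $k\in\{0,\dots,p^n-1\}$, $D_{p^n,k}$ is the formula $$\exists x,\; R(0,x,2x,\dots,(p^n-1)x)\wedge p^nx=k1_G.$$ *)

(* Defs.v *)
From mathcomp Require Import all_boot all_order all_algebra.
From mathcomp Require Import complex.
From mathcomp Require Import boolp classical_sets functions reals trigo.

Set Implicit Arguments.
Unset Strict Implicit.
Unset Printing Implicit Defensive.

Import Order.TTheory GRing.Theory Num.Theory.
Local Open Scope ring_scope.

Record is_cyclic_order (G : zmodType) (C : G -> G -> G -> Prop) : Prop := {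
  cyc_distinct : forall a b c, C a b c -> [/\ a <> b, b <> c & a <> c];
  cyc_rotate : forall a b c, C a b c -> C b c a;
  (* for every c, C c is a strict linear order on G \ {c}; its irreflexivity is
     an instance of cyc_distinct *)
  cyc_trans : forall c x y z, C c x y -> C c y z -> C c x z;
  cyc_total : forall c x y, x <> c -> y <> c -> x <> y -> C c x y \/ C c y x;
  cyc_translate : forall a b c u, C a b c -> C (a + u) (b + u) (c + u) }.

Record cycGroup := CycGroup {
  cyc_sort :> zmodType;
  cyc : cyc_sort -> cyc_sort -> cyc_sort -> Prop;
  cycP : is_cyclic_order cyc }.

(* R(x_1, ..., x_m); for m = 2 there are no triples and the convention is
   x_1 <> x_2.  Only used for m >= 2. *)
Definition cycs (G : cycGroup) (s : seq G) : Prop :=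
  match s with
  | [:: x; y] => x <> y
  | _ => forall i j k : nat, (i < j)%N -> (j < k)%N -> (k < size s)%N ->
           cyc s`_i s`_j s`_k
  end.

Definition is_one (G : cycGroup) (u : G) : Prop :=
  u <> 0 /\ forall y : G, y <> 0 -> y <> u -> cyc 0 u y.

Definition discrete (G : cycGroup) : Prop :=
  (forall x : G, x = 0) \/ (exists u : G, is_one u).

(* Only the values x 1, ..., x n of the family x matter. *)
Definition c_n_regular (n : nat) (G : cycGroup) : Prop :=
  forall x : nat -> G, cycs (0 :: [seq x i | i <- iota 1 n]) ->
  exists y : G,
    (y *+ n = x 1%N \/ y *+ n = x n \/ cyc (x 1%N) (y *+ n) (x n)) /\
    cycs (rcons [seq y *+ i | i <- iota 0 n] (x n)).

Definition c_regular (G : cycGroup) : Prop :=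
  forall n : nat, (2 <= n)%N -> c_n_regular n G.

Section Circle.
Variable R : realType.

Definition circle : set R[i] := [set z | `|z| = 1]%classic.

Definition expi (t : R) : R[i] := (cos t +i* sin t)%C.

Definition circle_cyc (z1 z2 z3 : R[i]) : Prop :=
  exists t1 t2 t3 : R,
    [/\ 0 <= t1 < 2 * pi, 0 <= t2 < 2 * pi & 0 <= t3 < 2 * pi] /\
    [/\ z1 = expi t1, z2 = expi t2 & z3 = expi t3] /\
    [\/ t1 < t2 < t3, t2 < t3 < t1 | t3 < t1 < t2].

Definition circle_subgroup (H : set R[i]) : Prop :=
  [/\ (H `<=` circle)%classic, H 1,
      forall z w, H z -> H w -> H (z * w) & forall z, H z -> H z^-1].

Definition c_archimedean (G : cycGroup) : Prop :=
  exists (H : set R[i]) (f : G -> R[i]),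
    [/\ circle_subgroup H, set_bij [set: G]%classic H f,
        forall a b, f (a + b) = f a * f b &
        forall a b c, cyc a b c <-> circle_cyc (f a) (f b) (f c)].

End Circle.

Inductive term : Type :=
  | Var of nat
  | Zero
  | Add of term & term
  | Opp of term.

Inductive formula : Type :=
  | Eq of term & term
  | Cyc of term & term & term
  | Not of formula
  | And of formula & formula
  | Exists of nat & formula.

Definition Forall (i : nat) (f : formula) : formula := Not (Exists i (Not f)).
Definition Or (f g : formula) : formula := Not (And (Not f) (Not g)).

Fixpoint term_fv (t : term) : seq nat :=
  match t with
  | Var i => [:: i]
  | Zero => [::]
  | Add t u => term_fv t ++ term_fv u
  | Opp t => term_fv t
  end.

Fixpoint fv (f : formula) : seq nat :=
  match f with
  | Eq t u => term_fv t ++ term_fv u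
  | Cyc t u v => term_fv t ++ term_fv u ++ term_fv v
  | Not f => fv f
  | And f g => fv f ++ fv g
  | Exists i f => [seq j <- fv f | j != i]
  end.

Definition sentence (f : formula) : Prop := fv f = [::].

Section Semantics.
Variable G : cycGroup.

Definition update (e : nat -> G) (i : nat) (a : G) : nat -> G :=
  fun j => if j == i then a else e j.

Fixpoint eval (e : nat -> G) (t : term) : G :=
  match t with
  | Var i => e i
  | Zero => 0
  | Add t u => eval e t + eval e u
  | Opp t => - eval e t
  end.

Fixpoint sat (e : nat -> G) (f : formula) : Prop :=
  match f with
  | Eq t u => eval e t = eval e u
  | Cyc t u v => cyc (eval e t) (eval e u) (eval e v)
  | Not f => ~ sat e f
  | And f g => sat e f /\ sat e g
  | Exists i f => exists a : G, sat (update e i a) f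
  end.

Definition models (f : formula) : Prop := forall e : nat -> G, sat e f.

End Semantics.

Definition elem_equiv (G H : cycGroup) : Prop :=
  forall f : formula, sentence f -> (models G f <-> models H f).

Definition Conj (fs : seq formula) : formula := foldr And (Eq Zero Zero) fs.

Definition Muln (n : nat) (t : term) : term := iter n (Add t) Zero.

Definition Cycs (s : seq term) : formula :=
  match s with
  | [:: t; u] => Not (Eq t u)
  | _ => Conj [seq Cyc (nth Zero s ij.1) (nth Zero s ij.2) (nth Zero s k)
              | k <- iota 0 (size s),
                ij <- [seq (i, j) | j <- iota 0 k, i <- iota 0 j]]
  end.

(* "Var i is the smallest element of G \ {0}"; Var 2 is the bound variable,
   so i must not be 2. *)
Definition IsOne (i : nat) : formula :=
  And (Not (Eq (Var i) Zero))
      (Forall 2 (Or (Eq (Var 2) Zero)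
                (Or (Eq (Var 2) (Var i)) (Cyc Zero (Var i) (Var 2))))).

(* D_{p^n,k}, the definable constant 1_G being eliminated: Var 0 stands for
   1_G and Var 1 for x. *)
Definition D (p n k : nat) : formula :=
  Exists 0 (And (IsOne 0)
    (Exists 1 (And (Cycs [seq Muln i (Var 1) | i <- iota 0 (p ^ n)])
                   (Eq (Muln (p ^ n) (Var 1)) (Muln k (Var 0)))))).

Section Reading.
Variable G : cycGroup.
Implicit Types (e : nat -> G) (f : formula) (t : term).

Lemma sat_Forall e i f :
  sat e (Forall i f) <-> forall a : G, sat (update e i a) f.
Proof.
split=> /= [h a|h [a]]; last by apply; apply: h.
by apply: contrapT => na; apply: h; exists a.
Qed.

Lemma sat_Or e f g : sat e (Or f g) <-> sat e f \/ sat e g.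
Proof.
split=> /= [h|[h|h] []//].
by apply: contrapT => /not_orP[nf ng]; apply: h.
Qed.

Lemma eval_Muln e n t : eval e (Muln n t) = eval e t *+ n.
Proof. by elim: n => //= n ->; rewrite mulrS. Qed.

Lemma sat_Conj (T : eqType) e (F : T -> formula) (r : seq T) :
  sat e (Conj [seq F x | x <- r]) <-> forall x, x \in r -> sat e (F x).
Proof.
elim: r => [|x r IH] //=; rewrite IH; split=> [[hx hr] y|h].
  by rewrite inE => /predU1P[->|/hr].
by split=> [|y yr]; apply: h; rewrite inE ?eqxx ?yr ?orbT.
Qed.

Lemma sat_Cycs e (s : seq term) :
  sat e (Cycs s) <-> cycs [seq eval e t | t <- s].
Proof.
have E i : (i < size s)%N -> [seq eval e t | t <- s]`_i = eval e (nth Zero s i).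
  by move=> h; rewrite (nth_map Zero).
suff H : sat e (Conj [seq Cyc (nth Zero s ij.1) (nth Zero s ij.2) (nth Zero s k)
              | k <- iota 0 (size s),
                ij <- [seq (i, j) | j <- iota 0 k, i <- iota 0 j]]) <->
    forall i j k : nat, (i < j)%N -> (j < k)%N ->
      (k < size [seq eval e t | t <- s])%N ->
      cyc [seq eval e t | t <- s]`_i [seq eval e t | t <- s]`_j
          [seq eval e t | t <- s]`_k.
  by case: s E H => [|t [|u [|v s]]].
rewrite size_map.
rewrite -(map_allpairs (fun q : nat * (nat * nat) =>
  Cyc (nth Zero s q.2.1) (nth Zero s q.2.2) (nth Zero s q.1)) pair).
rewrite sat_Conj; split=> [h i j k ij jk ks|h q].
  have js := ltn_trans jk ks; have ks' := ltn_trans ij js.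
  rewrite !E//; apply: (h (k, (i, j))).
  apply/allpairsPdep; exists k, (i, j); split=> //; rewrite ?mem_iota//.
  by apply/allpairsPdep; exists j, i; rewrite !mem_iota.
case/allpairsPdep=> k [q' [+ + ->]] /=; rewrite mem_iota /= add0n => ks.
case/allpairsPdep=> j [i [+ + ->]] /=; rewrite !mem_iota /= !add0n => jk ij.
have js := ltn_trans jk ks; have ks' := ltn_trans ij js.
by rewrite -!E//; apply: h.
Qed.

Lemma sat_IsOne e i : i != 2%N -> sat e (IsOne i) <-> is_one (e i).
Proof.
move=> i2; rewrite /IsOne /is_one.
have -> : sat e (And (Not (Eq (Var i) Zero))
  (Forall 2 (Or (Eq (Var 2) Zero)
            (Or (Eq (Var 2) (Var i)) (Cyc Zero (Var i) (Var 2)))))) <->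
  e i <> 0 /\ sat e (Forall 2 (Or (Eq (Var 2) Zero)
            (Or (Eq (Var 2) (Var i)) (Cyc Zero (Var i) (Var 2))))) by [].
have U a : update e 2 a i = e i by rewrite /update (negbTE i2).
rewrite sat_Forall; split=> -[nz h]; split=> // y.
  by have := h y; rewrite !sat_Or /= U /update /= => -[|[]].
rewrite !sat_Or /= U /update /=.
have [->|/eqP y0] := eqVneq y 0; first by left.
have [->|/eqP yi] := eqVneq y (e i); first by right; left.
by right; right; apply: h.
Qed.

Lemma models_D p n k :
  models G (D p n k) <->
  exists one : G, is_one one /\
    exists x : G, cycs [seq x *+ i | i <- iota 0 (p ^ n)] /\
      x *+ (p ^ n) = one *+ k.
Proof.
have S e : sat e (D p n k) <->
  exists one : G, is_one one /\
    exists x : G, cycs [seq x *+ i | i <- iota 0 (p ^ n)] /\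
      x *+ (p ^ n) = one *+ k.
  split=> -[u [hu [x [hx xk]]]]; exists u; split.
  - by move/sat_IsOne: hu; apply.
  - exists x; split; last by move: xk; rewrite /= !eval_Muln.
    move/sat_Cycs: hx; rewrite -map_comp; congr cycs.
    by apply: eq_map => i /=; rewrite eval_Muln.
  - by apply/sat_IsOne.
  - exists x; split; last by rewrite /= !eval_Muln.
    apply/sat_Cycs; rewrite -map_comp; move: hx; congr cycs.
    by apply: eq_map => i /=; rewrite eval_Muln.
by split=> [/(_ (fun=> 0))/S|/S h e] //; apply/S/S.
Qed.

End Reading.

Lemma fv_Cycs (P : pred nat) (s : seq term) :
  (forall m, all P (term_fv (nth Zero s m))) -> all P (fv (Cycs s)).
Proof.
move=> h; suff H (T : Type) (a b c : T -> nat) (r : seq T) :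
    all P (fv (Conj [seq Cyc (nth Zero s (a x)) (nth Zero s (b x))
                            (nth Zero s (c x)) | x <- r])).
  have H' := H _ (fun q : nat * (nat * nat) => q.2.1) (fun q => q.2.2) fst
    [seq (k, ij) | k <- iota 0 (size s),
                ij <- [seq (i, j) | j <- iota 0 k, i <- iota 0 j]].
  rewrite map_allpairs in H'.
  case: s h {H} H' => [|t [|u [|v s]]] //= h _.
  by rewrite all_cat; have:= h 0%N; have:= h 1%N => /= -> ->.
by elim: r => //= x r IH; rewrite !all_cat !h.
Qed.

Lemma D_sentence p n k : sentence (D p n k).
Proof.
have M m i (P : pred nat) : P i -> all P (term_fv (Muln m (Var i))).
  by move=> Pi; elim: m => //= m ->; rewrite Pi.
rewrite /sentence /=; apply/eqP; rewrite -[_ == _]negbK -has_filter.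
apply/hasPn => j; rewrite mem_filter => /andP[j1 jL]; rewrite negbK.
suff /allP/(_ _ jL) : all (fun j => (j == 0%N) || (j == 1%N))
    (fv (Cycs [seq Muln i (Var 1) | i <- iota 0 (p ^ n)]) ++
     term_fv (Muln (p ^ n) (Var 1)) ++ term_fv (Muln k (Var 0))).
  by rewrite (negbTE j1) orbF.
rewrite !all_cat !M // !andbT; apply: fv_Cycs => m.
have [ms|ms] := ltnP m (p ^ n); last by rewrite nth_default ?size_map ?size_iota.
by rewrite (nth_map 0%N) ?size_iota // M.
Qed.

(* Main.v *)
Require Import Defs.
From HB Require Import structures.
From mathcomp Require Import all_boot all_order all_algebra.
From mathcomp Require Import complex.
From mathcomp Require Import boolp classical_sets functions reals trigo.
From mathcomp Require Import zify ring lra.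

(* Proof idea.  A cyclically ordered group G is the quotient of its unwound
   group U, a linearly ordered group, by the subgroup generated by a positive
   z, and G is identified with [0, z[.  If G is discrete and not
   c-archimedean, then U is discrete with least positive element 1_G, and z is
   larger than every multiple of 1_G, since otherwise G would be finite cyclic.
   c-regularity applied to x, x + 1_G, ..., x + (n-1) 1_G makes one of them
   divisible by n in U, so U is a model of Presburger arithmetic.  There
   D_{p^n,k} says that p^n divides z + k 1_G; hence two groups satisfying the
   same D_{p^n,k} have constants z with the same residues modulo every M.  A
   back-and-forth argument for Presburger arithmetic with the additional
   constant z, which compares the signs of the integral linear forms with
   bounded coefficients and the residues modulo a fixed number, then gives
   elementary equivalence. *)

Set Implicit Arguments.
Unset Strict Implicit.
Unset Printing Implicit Defensive.

Import Order.TTheory GRing.Theory Num.Theory.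
Local Open Scope ring_scope.

(** * Discretely ordered abelian groups *)

(* The square-zero extension int (+) U is a commutative ring containing U, so
   identities in the abelian group U become goals of the ring tactic. *)
Definition sqz (U : zmodType) := (int * U)%type.
HB.instance Definition _ (U : zmodType) := GRing.Zmodule.on (sqz U).

Section SquareZero.
Variable U : zmodType.
Implicit Types x y z : sqz U.

Definition sqz_one : sqz U := (1, 0).
Definition sqz_mul x y : sqz U := (x.1 * y.1, y.2 *~ x.1 + x.2 *~ y.1).

Lemma sqz_mulA : associative sqz_mul.
Proof.
move=> x y z; congr pair; rewrite /= ?mulrA //.
by rewrite !mulrzDl -!mulrzA addrA [y.1 * _]mulrC [z.1 * _]mulrC.
Qed.

Lemma sqz_mulC : commutative sqz_mul.
Proof. by move=> x y; congr pair; rewrite /= 1?mulrC 1?addrC. Qed.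

Lemma sqz_mul1 : left_id sqz_one sqz_mul.
Proof. by case=> n u; congr pair; rewrite /= ?mul1r // mulr1z mul0rz addr0. Qed.

Lemma sqz_mulDl : left_distributive sqz_mul +%R.
Proof.
move=> x y z; congr pair; rewrite /= ?mulrDl //.
by rewrite mulrzDr mulrzDl addrACA.
Qed.

Lemma sqz_1_neq0 : sqz_one != 0 :> sqz U.
Proof. by []. Qed.

HB.instance Definition _ := GRing.Zmodule_isComNzRing.Build (sqz U)
  sqz_mulA sqz_mulC sqz_mul1 sqz_mulDl sqz_1_neq0.

Definition sqz_in (u : U) : sqz U := (0, u).

Lemma sqz_in_additive : zmod_morphism sqz_in.
Proof. by move=> u v; congr pair; rewrite /= subr0. Qed.

HB.instance Definition _ :=
  GRing.isZmodMorphism.Build U (sqz U) sqz_in sqz_in_additive.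

Lemma sqz_in_inj : injective sqz_in.
Proof. by move=> u v []. Qed.

End SquareZero.

Ltac zring := apply: sqz_in_inj; ring.

(** The order is given by its cone. [nonnegNP] is totality and discreteness in one: a negative x
    satisfies x <= -1. So a strict inequality x < y is written as [nonneg] of y - x - 1. *)
Record dogroup := DOGroup {
  dog_sort :> zmodType;
  nonneg : dog_sort -> Prop;
  unit1 : dog_sort;
  nonnegD : forall x y, nonneg x -> nonneg y -> nonneg (x + y);
  nonneg_anti : forall x, nonneg x -> nonneg (- x) -> x = 0;
  nonneg1 : nonneg unit1;
  unit1_neq0 : unit1 <> 0;
  nonnegNP : forall x, ~ nonneg x -> nonneg (- x - unit1) }.

(** Division with remainder by every n; together with discreteness this characterizes the Z-groups,
    the models of Presburger arithmetic. *)
Definition zgroup (U : dogroup) := forall n (x : U), (0 < n)%N ->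
  exists (q : U) (r : int), x = q *+ n + unit1 U *~ r.

Section DiscretelyOrdered.
Variable U : dogroup.
Implicit Types x y : U.
Local Notation P := (@nonneg U).
Local Notation "\1" := (unit1 U).

Lemma nonneg_eq x y : P x -> x = y -> P y.
Proof. by move=> ? <-. Qed.

Lemma nonneg0 : P 0.
Proof.
apply: contrapT => np; apply: (np); have h := nonnegNP np.
by apply: (nonneg_eq (nonnegD h (nonneg1 U))); zring.
Qed.

Lemma nonnegMn x n : P x -> P (x *+ n).
Proof.
move=> px; elim: n => [|n IH]; first exact: nonneg0.
by rewrite mulrS; apply: nonnegD.
Qed.

Lemma nonneg1n n : P (\1 *+ n).
Proof. exact/nonnegMn/nonneg1. Qed.

Lemma nonneg_neg1n n : ~ P (- (\1 *+ n.+1)).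
Proof.
move=> h; apply: (@unit1_neq0 U); apply: nonneg_anti; first exact: nonneg1.
by apply: (nonneg_eq (nonnegD h (nonneg1n n))); zring.
Qed.

(** Does the work of linear arithmetic: inequalities are refuted by adding them up to a negative
    multiple of 1. *)
Lemma nonneg_absurd x y n : P x -> P y -> x + y = - (\1 *+ n.+1) -> False.
Proof. by move=> px py e; apply: (@nonneg_neg1n n); rewrite -e; apply: nonnegD. Qed.

Lemma not_nonneg x : P (- x - \1) -> ~ P x.
Proof. by move=> h px; apply: (nonneg_absurd (n := 0) h px); zring. Qed.

Lemma nonneg_total x : P x \/ P (- x - \1).
Proof. by case: (pselect (P x)) => [|/nonnegNP]; [left|right]. Qed.

Lemma nonneg_gt0 x : P x -> x <> 0 -> P (x - \1).
Proof.
move=> px x0; have [h|h] := nonneg_total (- x); last by apply: nonneg_eq h _; zring.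
by case: x0; apply: nonneg_anti.
Qed.

Lemma nonnegMnI x n : (0 < n)%N -> P (x *+ n) -> P x.
Proof.
case: n => // n _ h; have [//|h'] := nonneg_total x; exfalso.
by apply: (nonneg_absurd (n := n) (nonnegMn n.+1 h') h); zring.
Qed.

Lemma dog_torsion x n : (0 < n)%N -> x *+ n = 0 -> x = 0.
Proof.
move=> n0 e; apply: nonneg_anti; apply: (nonnegMnI n0); rewrite ?mulNrn e ?oppr0;
  exact: nonneg0.
Qed.

Lemma dog_interval x n : P x -> P (\1 *+ n - x) ->
  exists2 i, (i <= n)%N & x = \1 *+ i.
Proof.
elim: n => [|n IH] px.
  by rewrite mulr0n add0r => nx; exists 0%N => //; exact: nonneg_anti.
have [h _|h h'] := nonneg_total (\1 *+ n - x).
  by have [i i1 ->] := IH px h; exists i => //; apply: leqW.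
exists n.+1 => //; apply/eqP; rewrite -subr_eq0; apply/eqP; apply: nonneg_anti.
  by apply: (nonneg_eq h); zring.
by apply: (nonneg_eq h'); zring.
Qed.

(** If r = s m + t with 0 < t < m, then w = q - s satisfies m w = t, so w is positive, hence at
    least 1, and m w >= m > t. *)
Lemma unit1_dvd (q : U) (r : int) m : (0 < m)%N -> \1 *~ r = q *+ m ->
  exists s, r = s * m%:Z.
Proof.
move=> m0 e; exists (r %/ m)%Z.
have [t tm et] : exists2 t : nat, (t < m)%N & (r %% m)%Z = t.
  exists `|(r %% m)%Z|%N; last by rewrite gez0_abs // modz_ge0 //; lia.
  by rewrite -ltz_nat gez0_abs ?modz_ge0 ?ltz_pmod //; lia.
have er : r = (r %/ m)%Z * m + t by rewrite {1}(divz_eq r m) et.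
set s := (r %/ m)%Z in er *.
case: t tm et er => [|t] tm et er; first by rewrite {1}er addr0.
pose w := q - \1 *~ s.
have ew : w *+ m = \1 *+ t.+1.
  have -> : w *+ m = q *+ m - \1 *~ (s * m) by rewrite /w; zring.
  by rewrite -e er; zring.
have pw : P w by apply: (nonnegMnI m0); rewrite ew; apply: nonneg1n.
have w0 : w <> 0.
  move=> w0; apply: (@nonneg_neg1n t); rewrite -ew w0 mul0rn oppr0; exact: nonneg0.
exfalso; apply: (@nonneg_neg1n (m - t.+2)%N).
apply: (nonneg_eq (nonnegMn m (nonneg_gt0 pw w0))).
have em : m = (t.+1 + (m - t.+2).+1)%N by lia.
rewrite mulrnBl ew [in X in _ - X]em; zring.
Qed.

End DiscretelyOrdered.

(** * Back-and-forth in Presburger arithmetic *)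

Section LinearForms.
Variables (I : finType) (U : zmodType).
Implicit Types (a : I -> U) (c d : {ffun I -> int}).

Definition lform a c : U := \sum_i a i *~ c i.

Lemma lformD a c d : lform a (c + d) = lform a c + lform a d.
Proof.
by rewrite -big_split; apply: eq_bigr => i _; rewrite ffunE mulrzDr.
Qed.

Lemma lformN a c : lform a (- c) = - lform a c.
Proof. by rewrite -sumrN; apply: eq_bigr => i _; rewrite ffunE mulrNz. Qed.

Lemma lformB a c d : lform a (c - d) = lform a c - lform a d.
Proof. by rewrite lformD lformN. Qed.

Lemma lformMn a c n : lform a (c *+ n) = lform a c *+ n.
Proof.
rewrite -sumrMnl; apply: eq_bigr => i _; rewrite ffunMnE; zring.
Qed.

Lemma lform0 a : lform a 0 = 0.
Proof. by apply: big1 => i _; rewrite ffunE mulr0z. Qed.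

Definition basis_coef (j : I) (r : int) : {ffun I -> int} :=
  [ffun i => if i == j then r else 0].

Lemma lform_basis a j r : lform a (basis_coef j r) = a j *~ r.
Proof.
rewrite /lform (bigD1 j) //= ffunE eqxx big1 ?addr0 // => i /negbTE ij.
by rewrite ffunE ij mulr0z.
Qed.

Definition set_at a j x : I -> U := fun i => if i == j then x else a i.

Definition zero_at c j : {ffun I -> int} := [ffun i => if i == j then 0 else c i].

Lemma lform_set a j x c :
  lform (set_at a j x) c = x *~ c j + lform a (zero_at c j).
Proof.
rewrite /lform !(bigD1 (P := predT) j) //= /set_at ffunE eqxx mulr0z add0r.
by congr (_ + _); apply: eq_bigr => i /negbTE ij; rewrite ffunE ij.
Qed.

Definition bounded (N : nat) c := forall i, (`|c i| <= N)%N.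

Lemma boundedN N c : bounded N c -> bounded N (- c).
Proof. by move=> h i; rewrite ffunE abszN. Qed.

Lemma boundedD M N c d : bounded M c -> bounded N d -> bounded (M + N) (c + d).
Proof.
move=> hc hd i; rewrite ffunE.
by move: (c i) (d i) (hc i) (hd i) => m n *; lia.
Qed.

Lemma boundedW M N c : (M <= N)%N -> bounded M c -> bounded N c.
Proof. by move=> mn h i; apply: leq_trans (h i) mn. Qed.

Lemma bounded0 N : bounded N 0.
Proof. by move=> i; rewrite ffunE. Qed.

Lemma bounded_basis j (r : int) N : (`|r| <= N)%N -> bounded N (basis_coef j r).
Proof. by move=> h i; rewrite ffunE; case: ifP. Qed.

Lemma boundedMn N c m : bounded N c -> bounded (N * m) (c *+ m).
Proof. by move=> h i; rewrite ffunMnE -mulr_natr natz abszM leq_mul. Qed.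

Lemma bounded_zero_at N c j : bounded N c -> bounded N (zero_at c j).
Proof. by move=> h i; rewrite ffunE; case: ifP. Qed.

(** Ordinals shifted by N encode the coefficients in [-N, N]. The list is finite, so
    [exists_nonneg_max] finds a largest form below a given element. *)
Definition all_bounded N : seq {ffun I -> int} :=
  [seq [ffun i => (f i : nat)%:Z - N%:Z] | f : {ffun I -> 'I_(N + N).+1}].

Lemma mem_all_bounded N c : bounded N c -> c \in all_bounded N.
Proof.
move=> h; apply/mapP; exists [ffun i => inord `|c i + N%:Z|].
  exact: mem_enum.
apply/ffunP => i; rewrite !ffunE; move: (c i) (h i) => m hm.
by rewrite inordK; lia.
Qed.

End LinearForms.

Lemma exists_nonneg_max (U : dogroup) (T : eqType) (f : T -> U) (Q : T -> Prop)
    (s : seq T) : (exists2 x, x \in s & Q x) ->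
  exists x, [/\ x \in s, Q x & forall y, y \in s -> Q y -> nonneg (f x - f y)].
Proof.
elim: s => [|t s IH]; first by case.
have nn0 x : nonneg (f x - f x) by rewrite subrr; apply: nonneg0.
have [/IH[m [ms qm hm]] _|ns] := pselect (exists2 x, x \in s & Q x); last first.
  case=> x; rewrite inE => /predU1P[->|xs] qx; last by case: ns; exists x.
  exists t; split; rewrite ?mem_head // => y; rewrite inE => /predU1P[->//|ys qy].
  by case: ns; exists y.
have [[qt lt]|nt] := pselect (Q t /\ nonneg (f t - f m)).
  exists t; split; rewrite ?mem_head // => y; rewrite inE => /predU1P[->//|ys qy].
  by apply: nonneg_eq (nonnegD lt (hm _ ys qy)) _; zring.
exists m; split; rewrite ?inE ?ms ?orbT // => y /predU1P[->|]; last exact: hm.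
move=> qt; have [h|h] := nonneg_total (f t - f m); first by case: nt.
by apply: nonneg_eq (nonnegD h (nonneg1 U)) _; zring.
Qed.

(** The integer r is a common representative, since elements of two groups cannot be subtracted. *)
Definition same_residue (M : nat) (U V : dogroup) (x : U) (y : V) : Prop :=
  exists r : int, (exists u, x = unit1 U *~ r + u *+ M) /\
                  (exists v, y = unit1 V *~ r + v *+ M).

Definition same_sign (U V : dogroup) (x : U) (y : V) : Prop :=
  (nonneg x <-> nonneg y) /\ (nonneg (- x) <-> nonneg (- y)).

Section Residues.
Variables (U V : dogroup) (M : nat).

Lemma same_residueC (x : U) (y : V) : same_residue M x y -> same_residue M y x.
Proof. by case=> r [? ?]; exists r. Qed.

Lemma same_residueD (x x' : U) (y y' : V) : same_residue M x y ->
  same_residue M x' y' -> same_residue M (x + x') (y + y').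
Proof.
case=> r [[u ->] [v ->]] [r' [[u' ->] [v' ->]]].
by exists (r + r'); split; [exists (u + u')|exists (v + v')]; zring.
Qed.

Lemma same_residueMz (x : U) (y : V) c : same_residue M x y ->
  same_residue M (x *~ c) (y *~ c).
Proof.
case=> r [[u ->] [v ->]].
by exists (r * c); split; [exists (u *~ c)|exists (v *~ c)]; zring.
Qed.

Lemma same_residue_unit1 r : same_residue M (unit1 U *~ r) (unit1 V *~ r).
Proof. by exists r; split; exists 0; zring. Qed.

Lemma same_residue0 : same_residue M (0 : U) (0 : V).
Proof. by exists 0; split; exists 0; zring. Qed.

Lemma same_residue_lform (I : finType) (a : I -> U) (b : I -> V) c :
  (forall i, same_residue M (a i) (b i)) -> same_residue M (lform a c) (lform b c).
Proof.
move=> h; apply: (big_ind2 (@same_residue M U V)) => [|*|i _].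
- exact: same_residue0.
- exact: same_residueD.
- exact/same_residueMz.
Qed.

Lemma same_residue_addl (x : U) (y : V) u : same_residue M x y ->
  same_residue M (x + u *+ M) y.
Proof.
by case=> r [[w ->] hy]; exists r; split=> //; exists (w + u); zring.
Qed.

End Residues.

Lemma same_residueW (U V : dogroup) M M' (x : U) (y : V) : (M %| M')%N ->
  same_residue M' x y -> same_residue M x y.
Proof.
case/dvdnP=> k -> [r [[u ->] [v ->]]].
by exists r; split; [exists (u *+ k)|exists (v *+ k)]; rewrite -!mulrnA.
Qed.

(** Modulo K M the element K x has residue r, so [unit1_dvd] makes r a multiple of K. Then K divides
    w too, and cancelling K turns the modulus K M into M. *)
Lemma same_residue_div (U V : dogroup) K M (x : U) (w : V) : (0 < K)%N ->
  same_residue (K * M) (x *+ K) w ->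
  exists2 y, w = y *+ K & same_residue M x y.
Proof.
move=> K0 [r [[u eu] [v ev]]].
have [r' er] : exists r', r = r' * K%:Z.
  apply: (unit1_dvd (U := U) (q := x - u *+ M) K0).
  have -> : (x - u *+ M) *+ K = x *+ K - u *+ (K * M) by zring.
  by rewrite eu; zring.
exists (unit1 V *~ r' + v *+ M); first by rewrite ev er; zring.
exists r'; split; last by exists v.
exists u; apply/eqP; rewrite -subr_eq0; apply/eqP; apply: (dog_torsion K0).
have -> : (x - (unit1 U *~ r' + u *+ M)) *+ K =
    x *+ K - (unit1 U *~ (r' * K%:Z) + u *+ (K * M)) by zring.
by rewrite eu er; zring.
Qed.

(* N bounds the coefficients of the forms whose signs agree; M is the modulus of
   the residues that agree. *)
Definition alike (I : finType) (N M : nat) (U V : dogroup)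
    (a : I -> U) (b : I -> V) : Prop :=
  (forall c, bounded N c -> (nonneg (lform a c) <-> nonneg (lform b c))) /\
  (forall i, same_residue M (a i) (b i)).

Lemma alikeC (I : finType) N M (U V : dogroup) (a : I -> U) (b : I -> V) :
  alike N M a b -> alike N M b a.
Proof.
by case=> hs hr; split=> [c /hs->//|i]; apply/same_residueC/hr.
Qed.

Lemma alikeW (I : finType) N N' M M' (U V : dogroup) (a : I -> U) (b : I -> V) :
  (N <= N')%N -> (M %| M')%N -> alike N' M' a b -> alike N M a b.
Proof.
move=> nn mm [hs hr]; split=> [c /(boundedW nn)/hs//|i].
exact: same_residueW mm (hr i).
Qed.

(** * One step of the back-and-forth *)

Section BackAndForth.
Variables (I : finType) (i0 : I) (U V : dogroup) (divU : zgroup U).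
Variables (a : I -> U) (b : I -> V).
Hypotheses (a0 : a i0 = unit1 U) (b0 : b i0 = unit1 V).

Lemma alike_sign N M c : alike N M a b -> bounded N c ->
  same_sign (lform a c) (lform b c).
Proof.
by case=> hs _ hc; split; [apply: hs|rewrite -!lformN; apply/hs/boundedN].
Qed.

(* Unless K x is itself a form, K y is taken in the residue class of K x, within
   K M above the largest form below K x.  The forms above K x are farther away:
   otherwise K x would be that largest form plus a small multiple of 1. *)
Lemma dilate_shift K B M (x : U) : (0 < K)%N -> (0 < M)%N ->
  alike (B + B + K * M) (K * M) a b ->
  exists2 y, same_residue M x y & forall d, bounded B d ->
    same_sign (x *+ K - lform a d) (y *+ K - lform b d).
Proof.
move=> K0 M0 hT.
have [[c hc ec]|nex] :=
    pselect (exists2 c, bounded (B + K * M) c & x *+ K = lform a c).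
  have : same_residue (K * M) (x *+ K) (lform b c).
    by rewrite ec; apply: same_residue_lform; case: hT.
  case/(same_residue_div K0)=> y ey hy; exists y => // d hd.
  rewrite ec -ey -!lformB; apply: alike_sign hT _.
  apply: boundedW (boundedD hc (boundedN hd)); lia.
(* For K x nonnegative the form 0 lies below K x, so a largest such form exists; otherwise -x is
   treated instead. *)
wlog px : x nex / nonneg (x *+ K).
  move=> W; have [px|px] := nonneg_total (x *+ K); first exact: W nex px.
  have [| |y hy hs] := W (- x).
  - case=> c hc ec; apply: nex; exists (- c); first exact: boundedN.
    by rewrite lformN -ec; zring.
  - by apply: nonneg_eq (nonnegD px (nonneg1 U)) _; zring.
  exists (- y).
    by have := same_residueMz (-1) hy; rewrite !mulrN1z opprK.
  move=> d /boundedN/hs[h1 h2].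
  have e1 : x *+ K - lform a d = - ((- x) *+ K - lform a (- d)).
    by rewrite lformN; zring.
  have e2 : (- y) *+ K - lform b d = - (y *+ K - lform b (- d)).
    by rewrite lformN; zring.
  by split; rewrite e1 e2 // !opprK.
have [|d0 [/mapP[f0 _ ed0] q0 hmax]] := @exists_nonneg_max U _ (lform a)
    (fun d => nonneg (x *+ K - lform a d)) (all_bounded I B).
  exists 0; first exact/mem_all_bounded/bounded0.
  by rewrite lform0 subr0.
have hd0 : bounded B d0.
  by move=> i; rewrite ed0 ffunE; move: (f0 i) => [m hm] /=; lia.
have KM0 : (0 < K * M)%N by rewrite muln_gt0 K0.
(* Subtracting 1 first makes s range over 1, ..., K M instead of 0, ..., K M - 1, so that K y = d0 +
   s lies strictly above d0. *)
have [q [r er]] := @divU _ (x *+ K - lform a d0 - unit1 U) KM0.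
have [s [t [s0 sKM es]]] : exists (s : nat) (t : int),
    [/\ (0 < s)%N, (s <= K * M)%N & r = t * (K * M)%N + s - 1].
  exists `|(r %% (K * M)%N)%Z|.+1, (r %/ (K * M)%N)%Z.
  have e := divz_eq r (K * M)%N; have l1 := @modz_ge0 r (K * M)%N.
  have l2 := @ltz_pmod r (K * M)%N.
  move: (K * M)%N (r %% _)%Z (r %/ _)%Z KM0 l1 l2 e => w m t w0 l1 l2 ->.
  split; lia.
have ex : x *+ K = lform a d0 + unit1 U *+ s + (q + unit1 U *~ t) *+ (K * M).
  have -> : x *+ K = x *+ K - lform a d0 - unit1 U + lform a d0 + unit1 U by zring.
  by rewrite er es; zring.
have [|y ey hy] := @same_residue_div U V K M x (lform b d0 + unit1 V *+ s) K0.
  rewrite ex; apply/same_residue_addl/same_residueD/(same_residue_unit1 _ _ _ s).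
  by apply: same_residue_lform; case: hT.
exists y => // d hd; rewrite -ey.
(* n = 0 compares d with d0, and n = s compares d with K y. The bounds B, K M and B of the three
   summands add up to that of [hT]. *)
have shift (n : nat) : (n <= K * M)%N -> same_sign
    (lform a d0 + unit1 U *+ n - lform a d) (lform b d0 + unit1 V *+ n - lform b d).
  move=> nKM; have := alike_sign (c := d0 + basis_coef i0 n - d) hT.
  rewrite !lformB !lformD !lform_basis a0 b0; apply.
  have hn : bounded (K * M) (basis_coef i0 n%:Z) by apply: bounded_basis.
  by apply: boundedW (boundedD (boundedD hd0 hn) (boundedN hd)); lia.
have ys : exists n, s = n.+1 by exists s.-1; lia.
case: ys => n sn.
have [pd|pd] := nonneg_total (x *+ K - lform a d).
  have qd : nonneg (lform b d0 - lform b d).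
    have [[+ _] _] := shift 0%N isT; rewrite !mulr0n !addr0; apply.
    exact: hmax (mem_all_bounded hd) pd.
  split; split=> // h.
  - apply: nonneg_eq (nonnegD qd (nonneg1n V s)) _; zring.
  - exfalso; apply: nex; exists d; first exact: boundedW (leq_addr _ _) hd.
    by apply/eqP; rewrite -subr_eq0; apply/eqP; apply: nonneg_anti.
  - exfalso; apply: (nonneg_absurd (n := n) qd h); rewrite sn; zring.
have npd := not_nonneg (x := x *+ K - lform a d) pd.
have pd' : nonneg (- (x *+ K - lform a d)).
  by apply: nonneg_eq (nonnegD pd (nonneg1 U)) _; zring.
have nq : ~ nonneg (lform b d0 + unit1 V *+ s - lform b d).
  have [[_ h] _] := shift s sKM; move=> /h h1.
  have [|i ilt ei] := @dog_interval U (x *+ K - lform a d0) s q0.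
    by apply: nonneg_eq (nonnegD h1 pd') _; zring.
  apply: nex; exists (d0 + basis_coef i0 i).
    by apply/(boundedD hd0)/bounded_basis; rewrite absz_nat; lia.
  rewrite lformD lform_basis a0 /= -[_ *~ _]ei; zring.
by split; split=> // _; apply: nonneg_eq (nonnegD (nonnegNP nq) (nonneg1 V)) _; zring.
Qed.

(** A nonzero coefficient g of the new element has |g| <= N, so it divides N!. Multiplying g x + d
    by m = N!/|g| keeps its sign and leaves N! x, up to sign, to be compared with a form bounded by
    N N!; [dilate_shift] with K = N! does this for all g at once. *)
Lemma alike_set N M : (0 < M)%N ->
  alike (N + (N * N`! + N * N`! + N`! * M)) (N`! * M) a b ->
  forall j x, exists y, alike N M (set_at a j x) (set_at b j y).
Proof.
move=> M0 hT j x.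
have [|y hy hs] := @dilate_shift N`! (N * N`!) M x (fact_gt0 N) M0.
  by apply: alikeW hT; rewrite ?leq_addl.
exists y; split=> [c hc|i]; last first.
  rewrite /set_at; case: eqP => // _; apply: same_residueW (proj2 hT i).
  exact: dvdn_mull.
have hc0 : bounded N (zero_at c j) by apply: bounded_zero_at.
rewrite !lform_set; move: (zero_at c j) (c j) (hc j) hc0 => d g gN hd.
have [->|g0] := eqVneq g 0.
  by rewrite !mulr0z !add0r; apply: (proj1 hT); apply: boundedW hd; lia.
have /dvdnP[m Km] : (`|g| %| N`!)%N by rewrite dvdn_fact // absz_gt0 g0.
have m0 : (0 < m)%N by case: m Km (fact_gt0 N) => // ->.
have nnM (W : dogroup) (w : W) : nonneg w <-> nonneg (w *+ m).
  by split; [apply: nonnegMn|apply: nonnegMnI].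
have hdm : bounded (N * N`!) (d *+ m).
  by apply: boundedW (boundedMn m hd); rewrite leq_mul2l Km leq_pmulr ?orbT ?absz_gt0.
rewrite (nnM U) (nnM V).
have [gp|gn] : g = `|g|%N \/ g = - `|g|%N%:Z by lia.
  have [h _] := hs _ (boundedN hdm); move: h; rewrite Km !lformN !lformMn.
  have e (W : zmodType) (w v : W) :
      w *+ (m * `|g|) - - (v *+ m) = (w *~ g + v) *+ m by rewrite gp /=; zring.
  by rewrite !e.
have [_ h] := hs _ hdm; move: h; rewrite Km !lformMn.
have e (W : zmodType) (w v : W) :
    - (w *+ (m * `|g|) - v *+ m) = (w *~ g + v) *+ m.
  by rewrite [in RHS]gn; zring.
by rewrite !e.
Qed.

End BackAndForth.

(** * The unwound group *)

Section OrderFromZero.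
Variable G : cycGroup.
Implicit Types x y w a b c : G.

Let ax := cycP G.

Lemma cyc_asym x y w : cyc x y w -> ~ cyc x w y.
Proof. by move=> h /(cyc_trans ax h)/(cyc_distinct ax)[]. Qed.

Lemma cyc_rot x y w : cyc x y w -> cyc w x y.
Proof. by move=> h; do 2!apply: (cyc_rotate ax). Qed.

(** The linear order obtained by cutting the circle at 0, with 0 as least element. *)
Definition lt0 x y : bool := `[< (x = 0 /\ y <> 0) \/ cyc 0 x y >].

Lemma lt0P x y : lt0 x y <-> (x = 0 /\ y <> 0) \/ cyc 0 x y.
Proof. by split=> /asboolP. Qed.

Lemma lt0_cyc x y : x <> 0 -> lt0 x y <-> cyc 0 x y.
Proof. by move=> x0; rewrite lt0P; split=> [[[]|]|] //; right. Qed.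

Lemma cyc_lt0 x y : cyc 0 x y -> lt0 x y.
Proof. by move=> h; apply/lt0P; right. Qed.

Lemma lt0_neq0 x y : lt0 x y -> y <> 0.
Proof. by case/lt0P=> [[]|/(cyc_distinct ax)[_ _ h] y0] //; apply: h. Qed.

Lemma lt00 y : lt0 0 y <-> y <> 0.
Proof.
by split=> [/lt0_neq0//|y0]; apply/lt0P; left.
Qed.

Lemma lt0_irr x : lt0 x x = false.
Proof. by apply/negP=> /lt0P[[]|/(cyc_distinct ax)[]] //. Qed.

Lemma lt0_trans y x w : lt0 x y -> lt0 y w -> lt0 x w.
Proof.
move=> hxy hyw; have y0 := lt0_neq0 hxy; have w0 := lt0_neq0 hyw.
case/lt0P: hxy => [[-> _]|hxy]; first exact/lt00.
by apply/cyc_lt0/(cyc_trans ax hxy)/lt0_cyc.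
Qed.

Lemma lt0_total x y : [\/ lt0 x y, x = y | lt0 y x].
Proof.
have [->|/eqP xy] := eqVneq x y; first exact: Or32.
have [x0|/eqP x0] := eqVneq x 0.
  by apply/Or31/lt0P; left; rewrite -x0; split=> // /esym.
have [y0|/eqP y0] := eqVneq y 0; first by apply/Or33/lt0P; left.
by have [h|h] := cyc_total ax x0 y0 xy; [apply/Or31/cyc_lt0|apply/Or33/cyc_lt0].
Qed.

Lemma lt0_cyc3 x y w : lt0 x y -> lt0 y w -> cyc x y w.
Proof.
move=> hxy hyw; have /lt0_cyc y0 := lt0_neq0 hxy.
move/y0: hyw => hyw; case/lt0P: hxy => [[-> _]//|hxy].
apply/(cyc_rot)/(cyc_trans ax (y := 0)); first exact: cyc_rotate ax _ _ _ hyw.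
exact: cyc_rot.
Qed.

Lemma cyc_lt0P x y w : cyc x y w <->
  [\/ lt0 x y /\ lt0 y w, lt0 y w /\ lt0 w x | lt0 w x /\ lt0 x y].
Proof.
split=> [h|]; last first.
  case=> -[h1 h2]; have h := lt0_cyc3 h1 h2 => //; first exact: cyc_rot.
  exact: (cyc_rotate ax).
have [xy yw xw] := cyc_distinct ax h; have nh := cyc_asym h.
have [hxy|//|hxy] := lt0_total x y; have [hyw|//|hyw] := lt0_total y w;
  have [hxw|//|hxw] := lt0_total x w;
  by [apply: Or31|apply: Or32|apply: Or33|case: nh; first [exact: lt0_cyc3
    |exact/cyc_rot/lt0_cyc3|exact/(cyc_rotate ax)/lt0_cyc3]].
Qed.

(** If -x came before -y, translation by x + y would give x < x + y < y. Translating these two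
    inequalities by -x and -y gives y < -x and -y < x, hence -y < x < y < -x after all. *)
Lemma cyc_opp x y : cyc 0 x y -> cyc 0 (- y) (- x).
Proof.
move=> h; have [x0 xy y0] := cyc_distinct ax h.
have [||e|//|h2] := @cyc_total G _ ax 0 (- y) (- x).
- by move/eqP; rewrite oppr_eq0 => /eqP/esym.
- by move/eqP; rewrite oppr_eq0 => /eqP/esym.
- by apply: xy; apply: oppr_inj.
have := cyc_translate ax (x + y) h2.
rewrite add0r addKr [x + y]addrC addKr [y + x]addrC => /cyc_rot h3.
have lxy := cyc_lt0 h.
have [hxs hsy] : lt0 x (x + y) /\ lt0 (x + y) y.
  case/cyc_lt0P: h3 => -[] // l1 l2.
    by have := lt0_trans l2 lxy; rewrite lt0_irr.
  by have := lt0_trans l1 lxy; rewrite lt0_irr.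
have h4 : cyc 0 y (- x).
  have /lt0_cyc/iffLR/(_ hxs) := not_eq_sym x0.
  move/(cyc_translate ax (- x)); rewrite add0r subrr addrAC subrr add0r.
  exact: (cyc_rotate ax).
have h5 : cyc 0 (- y) x.
  move: hsy => /lt0P[[s0]|].
    by have := lt0_neq0 hxs.
  by move/(cyc_translate ax (- y)); rewrite add0r subrr addrK => /cyc_rot.
by apply: (cyc_trans ax h5); apply: (cyc_trans ax h).
Qed.

Lemma cyc_addl a b : cyc 0 (a + b) a <-> cyc 0 (- a) b.
Proof.
split=> h.
  by have /cyc_rot := cyc_translate ax (- a) h; rewrite add0r subrr addrAC subrr add0r.
by have /(cyc_rotate ax) := cyc_translate ax a h; rewrite add0r addNr addrC.
Qed.

(** a + b < a amounts to -a < b, which [cyc_opp] turns into -b < a, the same statement with a and b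
    exchanged. *)
Lemma lt0_addlr a b : lt0 (a + b) a -> lt0 (a + b) b.
Proof.
case/lt0P=> [[e a0]|/cyc_addl/cyc_opp].
  by apply/lt0P; left; split=> // b0; apply: a0; rewrite -e b0 addr0.
by rewrite opprK => /cyc_addl; rewrite addrC => /cyc_lt0.
Qed.

Lemma cyc_subr a b : cyc 0 (b - a) b <-> cyc 0 a b.
Proof.
split=> h.
  have /cyc_rot := cyc_translate ax (- b) h.
  by rewrite add0r subrr addrAC subrr add0r => /cyc_opp; rewrite !opprK.
have /(cyc_rotate ax) := cyc_translate ax b (cyc_opp h).
by rewrite add0r addNr addrC.
Qed.

(* lt0 (a + b) a means that adding b to a goes past 0. *)
Definition carry a b : int := if lt0 (a + b) a then 1 else 0.

Lemma carryC a b : carry a b = carry b a.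
Proof.
rewrite /carry; congr (if _ then _ else _).
by apply/idP/idP => h; have := lt0_addlr h; rewrite addrC.
Qed.

(** The 2-cocycle identity, on which associativity in the unwound group rests. *)
Lemma carryA a b c :
  carry a b + carry (a + b) c = carry b c + carry a (b + c).
Proof.
(* carry b c, read in the order based at a, compares a + b and a + b + c. *)
have e : lt0 (b + c) b = `[< (a + (b + c) = a /\ a + b <> a) \/
    cyc a (a + (b + c)) (a + b) >].
  apply/asboolP/asboolP => -[[e n]|h].
  - by left; rewrite e addr0; split=> // /(canRL (addKr a)); rewrite addNr.
  - by right; have := cyc_translate ax a h; rewrite add0r ![_ + a]addrC.
  - left; split; first by rewrite -(addKr a (b + c)) e addNr.
    by move=> b0; apply: n; rewrite b0 addr0.
  - by right; have := cyc_translate ax (- a) h; rewrite subrr ![a + _]addrC !addrK.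
rewrite /carry e -!addrA.
move: (a + (b + c)) (a + b) => w y {e b c}.
have E (P : Prop) (b : bool) : (P <-> b) -> `[< P >] = b.
  by move=> h; apply/asboolP/idP => /h.
rewrite [`[< _ >]](E _ (((w == a) && (y != a)) || [|| lt0 a w && lt0 w y,
   lt0 w y && lt0 y a | lt0 y a && lt0 a w])); last first.
  rewrite cyc_lt0P; split=> [[[-> /eqP ->]|[][-> ->]]|]; rewrite ?eqxx ?orbT //.
  by case/orP=> [/andP[/eqP-> /eqP]|/or3P[]/andP[]]; [left|right; apply: Or31
    |right; apply: Or32|right; apply: Or33].
have as' x1 x2 : lt0 x1 x2 -> lt0 x2 x1 = false.
  by move=> h; apply/negP => /(lt0_trans h); rewrite lt0_irr.
have ne x1 x2 : lt0 x1 x2 -> ((x1 == x2) = false) * ((x2 == x1) = false).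
  move=> h; rewrite [x2 == _]eq_sym.
  by have /negbTE-> : x1 != x2 by apply: contraTneq h => ->; rewrite lt0_irr.
have bad x1 x2 x3 : lt0 x1 x2 -> lt0 x2 x3 -> lt0 x3 x1 -> False.
  by move=> h1 h2 /(lt0_trans (lt0_trans h1 h2)); rewrite lt0_irr.
(* Both sides now depend only on the relative order of a, y = a + b and w = a + b + c; every
   configuration is checked. *)
case: (lt0_total a y) => [h1|?|h1]; case: (lt0_total y w) => [h2|?|h2];
  case: (lt0_total a w) => [h3|?|h3]; subst; rewrite ?lt0_irr ?eqxx //;
  try match goal with
  | h1 : is_true (lt0 ?x ?y), h2 : is_true (lt0 ?y ?x) |- _ =>
      by rewrite (as' _ _ h1) in h2
  | h1 : is_true (lt0 ?x ?y), h2 : is_true (lt0 ?y ?z), h3 : is_true (lt0 ?z ?x)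
    |- _ => by case: (bad _ _ _ h1 h2 h3)
  | h : is_true (lt0 ?x ?x) |- _ => by rewrite lt0_irr in h
  end;
  repeat match goal with h : is_true (lt0 _ _) |- _ =>
    rewrite ?h ?(as' _ _ h) ?(ne _ _ h); clear h
  end; by [].
Qed.

End OrderFromZero.
(* Rieger's unwound group: the extension of G by Z z in which a + b picks up
   one z whenever the sum goes past 0 on the circle. *)
Definition unwound (G : cycGroup) := (int * G)%type.
HB.instance Definition _ (G : cycGroup) := Choice.on (unwound G).

(** * The unwound group as a discretely ordered group *)

Section Unwound.
Variable G : cycGroup.
Implicit Types (p q r : unwound G) (a b : G).

Lemma carry0r a : carry a 0 = 0.
Proof. by rewrite /carry addr0 lt0_irr. Qed.

Lemma carry_ge0 a b : 0 <= carry a b.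
Proof. by rewrite /carry; case: ifP. Qed.

Lemma carryNr a : carry (- a) a = (a != 0).
Proof.
rewrite /carry addNr; case: eqVneq => [->|/eqP a0]; first by rewrite oppr0 lt0_irr.
by case: (lt00 (- a)) => _ -> //; move/eqP; rewrite oppr_eq0 => /eqP.
Qed.

Definition unwound_add p q : unwound G := (p.1 + q.1 + carry p.2 q.2, p.2 + q.2).
Definition unwound_opp p : unwound G := (- p.1 - carry (- p.2) p.2, - p.2).

Lemma unwound_addA : associative unwound_add.
Proof.
move=> p q r; congr pair; rewrite /= ?addrA //.
have := carryA p.2 q.2 r.2; move: (carry _ _) (carry _ _) (carry _ _) (carry _ _).
by move=> c1 c2 c3 c4 e; lia.
Qed.

Lemma unwound_addC : commutative unwound_add.
Proof. by move=> p q; congr pair; rewrite /= 1?carryC 1?[p.1 + _]addrC 1?addrC. Qed.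

Lemma unwound_add0 : left_id (0, 0) unwound_add.
Proof. by case=> m a; congr pair; rewrite /= ?add0r // carryC carry0r addr0. Qed.

Lemma unwound_addN : left_inverse (0, 0) unwound_opp unwound_add.
Proof. by case=> m a; congr pair; rewrite /= ?addNr // addrAC addrNK addNr. Qed.

HB.instance Definition _ := GRing.isZmodule.Build (unwound G)
  unwound_addA unwound_addC unwound_add0 unwound_addN.

Lemma unwoundD p q : p + q = (p.1 + q.1 + carry p.2 q.2, p.2 + q.2).
Proof. by []. Qed.

Lemma unwoundN p : - p = (- p.1 - (p.2 != 0)%:Z, - p.2).
Proof. by rewrite -carryNr. Qed.

Lemma unwoundMn2 p n : (p *+ n).2 = p.2 *+ n.
Proof. by elim: n => // n IH; rewrite !mulrS -IH. Qed.

Variables (u : G) (hu : is_one u).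

Lemma lt0_sub_one a : a <> 0 -> lt0 (a - u) a.
Proof.
move=> a0; have [->|/eqP au] := eqVneq a u.
  by rewrite subrr; apply/lt00; case: hu.
by apply/cyc_lt0/cyc_subr; case: hu => _; apply.
Qed.

(** The component in G stands for a point of [0, z[, so the number of turns alone decides the
    sign. *)
Definition unwound_nonneg p : Prop := 0 <= p.1.

Lemma unwound_nonnegD p q :
  unwound_nonneg p -> unwound_nonneg q -> unwound_nonneg (p + q).
Proof. by move=> hp hq; rewrite /unwound_nonneg !addr_ge0 ?carry_ge0. Qed.

Lemma unwound_anti p : unwound_nonneg p -> unwound_nonneg (- p) -> p = 0.
Proof.
rewrite /unwound_nonneg unwoundN /= => p0; case: eqVneq => [a0|_] /= h; last by lia.
by case: p p0 a0 h => m a /= p0 -> h; congr pair; lia.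
Qed.

Definition unwound_one : unwound G := (0, u).

Lemma unwound_one_neq0 : unwound_one <> 0.
Proof. by case: hu => u0 _ [/u0]. Qed.

(** Subtracting 1 costs one turn. If p.2 is nonzero, [lt0_sub_one] gives it back as a carry; if p.2
    = 0, negating p has cost no turn. *)
Lemma unwound_nonnegNP p :
  ~ unwound_nonneg p -> unwound_nonneg (- p - unwound_one).
Proof.
rewrite /unwound_nonneg !unwoundN unwoundD /= => hp.
have -> /= : u != 0 by apply/eqP; case: hu.
case: eqVneq => [_|/eqP p0] /=.
  by have := carry_ge0 (- p.2) (- u); move: (carry _ _) => c hc; lia.
rewrite /carry lt0_sub_one; first by lia.
by move/eqP; rewrite oppr_eq0 => /eqP.
Qed.

Definition unwound_dogroup : dogroup := @DOGroup (unwound G) unwound_nonneg unwound_one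
  unwound_nonnegD unwound_anti (lexx 0) unwound_one_neq0 unwound_nonnegNP.

Local Notation U := unwound_dogroup.
Local Notation "\1" := (unit1 U).

(** One full turn. [roll] is the projection onto G that kills it, and [unroll] its section with
    values in [0, z[. *)
Definition winding : U := (1, 0).
Local Notation z := winding.
Definition unroll (a : G) : U := (0, a).
Definition roll (x : U) : G := x.2.

Lemma windingMz k : z *~ k = (k, 0).
Proof.
have h n : (z : unwound G) *+ n = (n%:Z, 0).
  elim: n => // n IH; rewrite mulrS IH unwoundD /= carry0r !addr0; congr pair; lia.
case: k => n; first exact: h.
by rewrite NegzE mulrNz /= -pmulrn h unwoundN /= eqxx subr0 oppr0.
Qed.

Lemma rollD x y : roll (x + y) = roll x + roll y. Proof. by []. Qed.

Lemma rollMn x n : roll (x *+ n) = roll x *+ n. Proof. exact: unwoundMn2. Qed.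

Lemma unroll0 : unroll 0 = 0. Proof. by []. Qed.

Lemma unrollK a : roll (unroll a) = a. Proof. by []. Qed.

Lemma unrollD a b : unroll a + unroll b = unroll (a + b) + z *~ carry a b.
Proof. by rewrite windingMz !unwoundD /= !add0r carry0r !addr0. Qed.

Lemma unroll_roll x : x = unroll (roll x) + z *~ x.1.
Proof. by rewrite windingMz unwoundD /= carry0r addr0 add0r addr0; case: x. Qed.

Lemma unroll_nonneg a : nonneg (unroll a).
Proof. exact: lexx. Qed.

Lemma unroll_ltz a : nonneg (z - unroll a - \1).
Proof.
apply: nonneg_eq (nonnegNP (d := U) (x := unroll a - z) _) _; last by zring.
by rewrite /= /unwound_nonneg unwoundN unwoundD /= eqxx !oppr0 carry0r.
Qed.

Lemma rollK x : nonneg x -> nonneg (z - x - \1) -> unroll (roll x) = x.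
Proof.
move=> h0 h1; suff e : x.1 = 0 by rewrite /unroll /roll -e -surjective_pairing.
have : ~ nonneg (x - z) by apply: not_nonneg; apply: nonneg_eq h1 _; zring.
move: h0; rewrite /= /unwound_nonneg unwoundN unwoundD /= eqxx !oppr0 carry0r.
by move: x.1 => m; lia.
Qed.

Lemma unroll_lt a b : nonneg (unroll b - unroll a - \1) <-> lt0 a b.
Proof.
have -> : nonneg (unroll b - unroll a - \1) <-> ~ nonneg (unroll a - unroll b).
  have e : unroll b - unroll a - \1 = - (unroll a - unroll b) - \1 by zring.
  by rewrite e; split=> [/not_nonneg|/nonnegNP].
rewrite /= /unwound_nonneg unwoundN unwoundD /=.
case: eqVneq => [->|/eqP b0] /=.
  rewrite !oppr0 carry0r; split=> // /lt0_neq0 //.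
(* For nonzero b, subtracting b from a borrows a turn exactly when a comes before b. *)
have -> : lt0 a b <-> ~ lt0 (a - b) a.
  have [->|/eqP a0] := eqVneq a 0.
    split=> [_ /lt0_neq0//|_]; exact/lt00.
  have [->|/eqP ab] := eqVneq a b.
    by rewrite lt0_irr subrr; split=> // h; case: h; apply/lt00.
  rewrite (@lt0_cyc _ (a - b)); last by move/eqP; rewrite subr_eq0 => /eqP.
  rewrite cyc_subr -lt0_cyc //.
  split=> [h /(lt0_trans h)|h]; first by rewrite lt0_irr.
  by case: (lt0_total a b).
by rewrite /carry; case: ifP; split.
Qed.

Lemma cyc0_unroll a b : cyc 0 a b -> nonneg (unroll b - unroll a - \1).
Proof. by move/cyc_lt0/unroll_lt. Qed.

End Unwound.

(** * Regularity and the formulas D *)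

Section Cycs.
Variable G : cycGroup.

Lemma cycs_incr (s : seq G) :
  (forall i j, (i < j)%N -> (j < size s)%N -> lt0 s`_i s`_j) -> cycs s.
Proof.
move=> h; suff H : forall i j k : nat, (i < j)%N -> (j < k)%N -> (k < size s)%N ->
    cyc s`_i s`_j s`_k.
  case: s h H => [|x [|y [|w s]]] //= h _ xy.
  by have := h 0%N 1%N isT isT; rewrite /= xy lt0_irr.
by move=> i j k ij jk ks; apply: lt0_cyc3; apply: h => //; apply: ltn_trans ks.
Qed.

Lemma cycs3 (s : seq G) : (3 <= size s)%N -> cycs s ->
  forall i j k : nat, (i < j)%N -> (j < k)%N -> (k < size s)%N -> cyc s`_i s`_j s`_k.
Proof. by case: s => [|x [|y [|w s]]]. Qed.

Lemma nth_map_iota (f : nat -> G) n i : (i < n)%N -> [seq f j | j <- iota 0 n]`_i = f i.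
Proof. by move=> h; rewrite (nth_map 0%N) ?size_iota // nth_iota. Qed.

Lemma is_one_uniq (u v : G) : is_one u -> is_one v -> u = v.
Proof.
move=> [u0 hu] [v0 hv]; apply: contrapT => uv.
by have := cyc_asym (hu v v0 (not_eq_sym uv)); case; apply/cyc_rot/cyc_rot/cyc_rot/hv.
Qed.

End Cycs.

(** * Divisibility when z exceeds every multiple of 1 *)

Section InfiniteWinding.
Variables (G : cycGroup) (u : G) (hu : is_one u).
Local Notation U := (unwound_dogroup hu).
Local Notation P := (@nonneg U).
Local Notation "\1" := (unit1 U).
Local Notation z := (winding hu).
Local Notation unroll := (unroll hu).

Lemma unrollD_or a b :
  unroll (a + b) = unroll a + unroll b \/
  unroll (a + b) = unroll a + unroll b - z.
Proof.
rewrite unrollD /carry; case: ifP => _; first by right; zring.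
by left; zring.
Qed.

(** The multiples increase, so no addition of y passes 0 and no carry arises. *)
Lemma unroll_Mn (y : G) n :
  (forall i, (0 < i)%N -> (i.+1 < n)%N -> cyc 0 (y *+ i) (y *+ i.+1)) ->
  forall i, (i < n)%N -> unroll (y *+ i) = unroll y *+ i.
Proof.
move=> h; elim=> [|[|i] IH] hi; rewrite ?mulr0n ?mulr1n //.
have := unrollD hu (y *+ i.+1) y; rewrite IH; last exact: ltnW.
move=> e; rewrite [RHS]mulrSr e /carry -mulrSr.
have /cyc_lt0 l := h i.+1 isT hi.
case: ifP => [l'|_]; first by have := lt0_trans l l'; rewrite lt0_irr.
zring.
Qed.

Hypothesis winding_infinite : forall n, P (z - \1 *+ n).

Lemma unroll_one_Mn k : unroll (u *+ k) = \1 *+ k.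
Proof.
rewrite -[RHS](rollK (hu := hu)) ?rollMn //; first exact: nonneg1n.
by apply: nonneg_eq (winding_infinite k.+1) _; zring.
Qed.

(** Regularity at the n consecutive points x, ..., x + n - 1, which lie in ]0, z[, gives y with n y
    among them, that is n y = x + i. It remains to see that the unrolled y satisfies this in U as
    well. *)
Lemma regular_div n (x : U) : (2 <= n)%N -> c_n_regular n G ->
  P (x - \1) -> P (z - x - \1 *+ n) ->
  exists (q : U) (r : int), x = q *+ n + \1 *~ r.
Proof.
move=> n2 reg px pz.
(* Index 0 is the leading 0 of the regularity condition, and [w j.+1] is the point x + j. *)
pose w i := roll (if i is j.+1 then x + \1 *+ j else 0).
have lw j : (j < n)%N -> unroll (w j.+1) = x + \1 *+ j.
  move=> jn; apply: rollK.
    apply: nonneg_eq (nonnegD px (nonneg1n U j.+1)) _; zring.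
  apply: nonneg_eq (nonnegD pz (nonneg1n U (n - j.+1))) _.
  have {1}-> : n = (j.+1 + (n - j.+1))%N by lia.
  by zring.
have [|y [hy hc]] := reg w.
  have -> : 0 :: [seq w i | i <- iota 1 n] = [seq w i | i <- iota 0 n.+1] by [].
  apply: cycs_incr => i j ij; rewrite size_map size_iota => jn.
  rewrite !nth_map_iota //; last exact: ltn_trans ij jn.
  apply/(unroll_lt hu); case: j ij jn => // j ij jn; rewrite lw //.
  case: i ij => [|i] ij.
    rewrite /w unroll0; apply: nonneg_eq (nonnegD px (nonneg1n U j)) _; zring.
  rewrite lw; last by lia.
  apply: nonneg_eq (nonneg1n U (j - i.+1)) _.
  have {2}-> : j = (i.+1 + (j - i.+1))%N by lia.
  by zring.
have sz : size (rcons [seq y *+ i | i <- iota 0 n] (w n)) = n.+1.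
  by rewrite size_rcons size_map size_iota.
have hcyc i j k : (i < j)%N -> (j < k)%N -> (k <= n)%N ->
    cyc (if (i < n)%N then y *+ i else w n) (if (j < n)%N then y *+ j else w n)
        (if (k < n)%N then y *+ k else w n).
  have e l : (l <= n)%N -> (rcons [seq y *+ i | i <- iota 0 n] (w n))`_l =
      if (l < n)%N then y *+ l else w n.
    move=> ln; rewrite nth_rcons size_map size_iota.
    case: ltnP => [h|h]; first by rewrite nth_map_iota.
    by have -> : l = n by [lia]; rewrite eqxx.
  move=> ij jk kn; rewrite -!e //; try lia.
  by apply: (cycs3 _ hc); rewrite ?sz.
have lY : forall i, (i < n)%N -> unroll (y *+ i) = unroll y *+ i.
  apply: unroll_Mn => i i0 i1; have := hcyc 0%N i i.+1 i0 (ltnSn _) (ltnW i1).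
  by rewrite i1 !ifT //; lia.
(* From here on the divisor is [n.+1], and the last point is x + n. *)
case: n n2 reg pz lw hy hc sz hcyc lY => // n n2 reg pz lw hy hc sz hcyc lY.
have lt_last : P (x + \1 *+ n - unroll y *+ n - \1).
  rewrite -lw // -lY //; apply: cyc0_unroll.
  have := hcyc 0%N n n.+1 n2 (ltnSn _) (leqnn _).
  by rewrite !ltnSn ltnn.
have l1 : unroll (w 1%N) = x by rewrite lw // addr0.
set t := unroll (y *+ n.+1); have [t1 t2] : P (t - x) /\ P (x + \1 *+ n - t).
  rewrite -lw // -{1}l1.
  have lwn : P (unroll (w n.+1) - unroll (w 1%N)).
    by rewrite l1 lw //; apply: nonneg_eq (nonneg1n U n) _; zring.
  have l1n : lt0 (w 1%N) (w n.+1).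
    apply/(unroll_lt hu); rewrite l1 lw //.
    by apply: nonneg_eq (nonneg1n U n.-1) _; rewrite -{2}(prednK n2); zring.
  have ws v v' : lt0 v v' -> P (unroll v' - unroll v).
    by move/(unroll_lt hu)=> h; apply: nonneg_eq (nonnegD h (nonneg1 U)) _; zring.
  case: hy => [e|[e|hy]]; rewrite /t ?e ?subrr; split; rewrite ?subrr //;
    try exact: nonneg0.
    case/cyc_lt0P: hy => -[h1 h2]; try exact: ws.
    by have := lt0_trans l1n h2; rewrite lt0_irr.
  case/cyc_lt0P: hy => -[h1 h2]; try exact: ws.
  by have := lt0_trans l1n h1; rewrite lt0_irr.
have [i _ ei] : exists2 i, (i <= n)%N & t - x = \1 *+ i.
  by apply: dog_interval => //; apply: nonneg_eq t2 _; zring.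
(* By [lY] only the last addition of y can pass 0. *)
have et : t = unroll y *+ n.+1 \/ t = unroll y *+ n.+1 - z.
  by rewrite /t mulrSr mulrSr -lY //; apply: unrollD_or.
case: et => et.
  exists (unroll y), (- i%:Z); rewrite -et.
  have -> : x = t - (t - x) by zring.
  by rewrite ei; zring.
(* Here n y goes past 0 on the circle, which forces y > z - n although
   (n - 1) y < z. *)
exfalso; set Y := unroll y in et lt_last.
have yz := unroll_ltz hu y; have y0 := unroll_nonneg hu y; rewrite -/Y in yz y0.
have h1 := nonnegD t1 lt_last; rewrite et in h1.
case: n n2 {reg w hy hc sz hcyc lY t t1 t2 l1 lw ei et} pz lt_last h1 =>
  // -[|n] _ pz lt_last h1.
  by apply: (nonneg_absurd (n := 0) h1 yz); zring.
(* [h2] says 2 Y < z, while [h1] puts Y within a finite distance of z; this would bound z. *)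
have h2 := nonnegD (nonnegD pz lt_last) (nonnegMn n y0).
have h3 := nonnegD (nonnegMn 2 h1) (winding_infinite (2 * n + 1)).
by apply: (nonneg_absurd (n := 0) h2 h3); rewrite mulnC; zring.
Qed.

(** The elements that admit division by n form a subgroup containing 1. [regular_div] puts into it
    the points from 1 to z - n; points closer to z are first moved down by n, and so is z itself. *)
Lemma unwound_zgroup : c_regular G -> zgroup U.
Proof.
move=> reg n x n0; have [n2|n1] := ltnP 1 n; last first.
  by exists x, 0; have -> : n = 1%N by [lia]; zring.
pose Dn (y : U) := exists (q : U) (r : int), y = q *+ n + \1 *~ r.
have DD y y' : Dn y -> Dn y' -> Dn (y + y').
  by move=> [q [r ->]] [q' [r' ->]]; exists (q + q'), (r + r'); zring.
have DM y k : Dn y -> Dn (y *~ k).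
  by move=> [q [r ->]]; exists (q *~ k), (r * k); zring.
have Dint y : P (y - \1) -> P (z - y - \1 *+ n) -> Dn y.
  exact: regular_div (reg n n2).
have Dz : Dn z.
  have -> : z = (z - \1 *+ n) + \1 *+ n by zring.
  apply: DD; last by exists 0, n%:Z; zring.
  apply: Dint; first by apply: nonneg_eq (winding_infinite n.+1) _; zring.
  by apply: nonneg_eq (nonneg0 U) _; zring.
rewrite (unroll_roll x); apply: (DD); last exact: DM.
move: (roll x) => a; have h0 := unroll_nonneg hu a.
have [h1|h1] := nonneg_total (unroll a - \1); last first.
  have -> : unroll a = 0.
    by apply: nonneg_anti => //; apply: nonneg_eq h1 _; zring.
  by exists 0, 0; zring.
have [h2|h2] := nonneg_total (z - unroll a - \1 *+ n); first exact: Dint.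
have -> : unroll a = (unroll a - \1 *+ n) + \1 *+ n by zring.
apply: DD; last by exists 0, n%:Z; zring.
apply: Dint.
  have h3 := nonnegD h2 (winding_infinite (2 * n)).
  by apply: nonneg_eq h3 _; rewrite mulnC; zring.
by apply: nonneg_eq (nonnegD (unroll_ltz hu a) (nonneg1 U)) _; zring.
Qed.

(** With N = p^n and X the unrolled x, the equation N x = k in G means N X = k or N X = z + k in U.
    The former fails because X >= 1 and k < N. Conversely a solution q in U projects to a
    witness. *)
Lemma models_D_winding p n k : (2 <= p ^ n)%N -> (k < p ^ n)%N ->
  models G (D p n k) <-> exists q : U, q *+ (p ^ n) = z + \1 *+ k.
Proof.
rewrite models_D; move: (p ^ n)%N => N N2 kN; split=> [[u' [hu' [x [hc ex]]]]|[q eq]].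
  rewrite (is_one_uniq hu' hu) {u' hu'} in ex.
  have sz : size [seq x *+ i | i <- iota 0 N] = N by rewrite size_map size_iota.
  have hX : forall i, (i < N)%N -> unroll (x *+ i) = unroll x *+ i.
    apply: unroll_Mn => i i0 iN; have N3 : (2 < N)%N by lia.
    have := cycs3 _ hc i0 (ltnSn i); rewrite sz => /(_ N3 iN).
    by rewrite !nth_map_iota //; lia.
  have x0 : x <> 0.
    (* For N = 2 the list has two entries, and [cycs] says directly that they differ. *)
    have := hc; case: (N) N2 => [|[|[|m]]] // _ h x0.
      by case: h; rewrite x0 mul0rn.
    have := @cycs3 _ [seq x *+ i | i <- iota 0 m.+3] isT h 0%N 1%N 2%N isT isT isT.
    by move/(cyc_distinct (cycP G)) => [e _ _]; case: e; rewrite /= x0.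
  have X1 : P (unroll x - \1).
    by have /lt00/(unroll_lt hu) := x0; rewrite unroll0 subr0.
  have : unroll (x *+ N) = unroll x *+ N \/ unroll (x *+ N) = unroll x *+ N - z.
    case: N N2 {kN ex sz hc} hX => // N _ hX.
    by rewrite !mulrSr -hX //; apply: unrollD_or.
  rewrite ex unroll_one_Mn => -[e|e]; last by exists (unroll x); rewrite e; zring.
  exfalso; apply: (nonneg_absurd (n := (N - k.+1)%N) (nonnegMn N X1) (nonneg0 U)).
  have eN : N = (k + (N - k.+1).+1)%N by lia.
  by rewrite mulrnBl -e [in X in _ - X]eN; zring.
(* This keeps the largest multiple (N - 1) q = z + k - q below z. *)
have q1 : P (q - \1 *+ k.+1).
  apply: (nonnegMnI (n := N)); first by lia.
  apply: nonneg_eq (nonnegD (winding_infinite (k.+1 * N)) (nonneg1n U k)) _.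
  by rewrite mulrnBl eq; zring.
have q0 : P (q - \1) by apply: nonneg_eq (nonnegD q1 (nonneg1n U k)) _; zring.
have q00 : P q by apply: nonneg_eq (nonnegD q0 (nonneg1 U)) _; zring.
have qz i : (i < N)%N -> P (z - q *+ i - \1).
  move=> iN; apply: nonneg_eq (nonnegD (nonnegMn (N - i.+1) q00) q1) _.
  have -> : z = q *+ N - \1 *+ k by rewrite eq; zring.
  have {2}-> : N = (i + (N - i.+1).+1)%N by lia.
  by zring.
have rq i : (i < N)%N -> unroll (roll q *+ i) = q *+ i.
  by move=> iN; rewrite -rollMn rollK //; [apply: nonnegMn|apply: qz].
exists u; split=> //; exists (roll q); split.
  apply: cycs_incr => i j ij; rewrite size_map size_iota => jN.
  have iN := ltn_trans ij jN.
  rewrite !nth_map_iota //; apply/(unroll_lt hu); rewrite !rq //.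
  apply: nonneg_eq (nonnegD q0 (nonnegMn (j - i.+1) q00)) _.
  have {2}-> : j = (i + (j - i.+1).+1)%N by lia.
  by zring.
by rewrite -rollMn eq rollD rollMn /= add0r.
Qed.

End InfiniteWinding.

(** * Finite cyclic groups embed in the circle *)

Section Circle.
Variable R : realType.
Implicit Types s t : R.

Lemma expiD s t : expi (s + t) = expi s * expi t.
Proof. by rewrite /expi cosD sinD [sin s * _ + _]addrC. Qed.

Lemma expi0 : expi 0 = 1 :> R[i].
Proof. by rewrite /expi cos0 sin0. Qed.

Lemma expi_2pi : expi (2 * pi) = 1 :> R[i].
Proof. by rewrite /expi mulr_natl cos2pi sin2pi. Qed.

Lemma norm_expi t : `|expi t| = 1.
Proof. by rewrite normc_def /= cos2Dsin2 sqrtr1. Qed.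

(** For s < t the half difference lies strictly between 0 and pi, where the sine is positive; but
    cos (t - s) = 1 makes its sine vanish. *)
Lemma expi_inj s t : 0 <= s < 2 * pi -> 0 <= t < 2 * pi ->
  expi s = expi t -> s = t.
Proof.
wlog st : s t / s <= t.
  move=> W hs ht e; have [st|/ltW ts] := leP s t; first exact: W.
  by apply/esym/W.
move=> hs ht [ec es]; apply: contrapT => nst.
have lst : s < t by rewrite lt_neqAle st andbT; apply/eqP.
have c1 : cos (t - s) = 1 by rewrite cosB ec es -!expr2 cos2Dsin2.
have : 0 < sin ((t - s) / 2) by apply: sin_gt0_pi; lra.
have := cos_mulr2n ((t - s) / 2).
have -> : (t - s) / 2 *+ 2 = t - s by field.
rewrite c1 cos2sin2 => e2.
have /eqP : sin ((t - s) / 2) ^+ 2 = 0 by lra.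
by rewrite sqrf_eq0 => /eqP ->; rewrite ltxx.
Qed.

Lemma circle_cyc_expi t1 t2 t3 :
  0 <= t1 < 2 * pi -> 0 <= t2 < 2 * pi -> 0 <= t3 < 2 * pi ->
  circle_cyc (expi t1) (expi t2) (expi t3) <->
  [\/ t1 < t2 < t3, t2 < t3 < t1 | t3 < t1 < t2].
Proof.
move=> h1 h2 h3; split=> [[s1 [s2 [s3 [[k1 k2 k3] [[e1 e2 e3] h]]]]]|h].
  by rewrite (expi_inj h1 k1 e1) (expi_inj h2 k2 e2) (expi_inj h3 k3 e3).
by exists t1, t2, t3.
Qed.

Lemma trivial_c_archimedean (G : cycGroup) :
  (forall x : G, x = 0) -> c_archimedean R G.
Proof.
move=> G0; exists [set 1]%classic, (fun=> 1).
have no0 : 0 <= (0 : R) < 2 * pi by rewrite lexx mulr_gt0 ?pi_gt0.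
split=> [|||a b c].
- split=> [z ->|//|z w -> ->|z ->]; rewrite /circle /= ?normr1 ?mulr1 ?invr1 //.
- split=> [x|x y _ _ _|y ->] //; first by rewrite (G0 x) (G0 y).
  by exists 0.
- by move=> a b; rewrite mulr1.
split=> [/(cyc_distinct (cycP G))[]|]; first by rewrite (G0 a) (G0 b).
rewrite -expi0; case/(circle_cyc_expi no0 no0 no0)=> /andP[];
  by rewrite ltxx.
Qed.

End Circle.

Section FiniteWinding.
Variables (R : realType) (G : cycGroup) (u : G) (hu : is_one u).
Local Notation U := (unwound_dogroup hu).
Local Notation P := (@nonneg U).
Local Notation "\1" := (unit1 U).
Local Notation z := (winding hu).
Local Notation unroll := (unroll hu).

Lemma nonneg_unit1 (V : dogroup) i j :
  nonneg (unit1 V *+ i - unit1 V *+ j) <-> (j <= i)%N.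
Proof.
split=> h; last first.
  by apply: nonneg_eq (nonneg1n V (i - j)) _; rewrite -{2}(subnK h); zring.
rewrite leqNgt; apply/negP=> ij.
apply: (nonneg_absurd (n := (j - i.+1)%N) h (nonneg0 V)).
have {1}-> : j = (i + (j - i.+1).+1)%N by lia.
by zring.
Qed.

Lemma unit1_inj (V : dogroup) i j : unit1 V *+ i = unit1 V *+ j -> i = j.
Proof.
move=> e; apply/eqP; rewrite eqn_leq.
by apply/andP; split; apply/(nonneg_unit1 V); rewrite e subrr; apply: nonneg0.
Qed.

(** Each point of [0, z[ is then a multiple of 1 below m, so G is cyclic of order m and goes to the
    m-th roots of unity; subtracting z becomes a rotation by 2 pi. *)
Lemma finite_c_archimedean m : z = \1 *+ m -> c_archimedean R G.
Proof.
move=> zm.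
have m0 : (0 < m)%N.
  by case: m zm.
have [ix hix] : {ix : G -> nat & forall a, (ix a < m)%N /\ unroll a = \1 *+ ix a}.
  apply: (@choice _ _ (fun a i => (i < m)%N /\ unroll a = \1 *+ i)) => a.
  have [||i im ->] := @dog_interval U (unroll a) m.-1.
  - exact: unroll_nonneg.
  - apply: nonneg_eq (unroll_ltz hu a) _; rewrite zm -{1}(prednK m0); zring.
  - by exists i; split=> //; rewrite -(prednK m0).
have ixm a := proj1 (hix a); have eix a := proj2 (hix a).
have lt0_ix a b : lt0 a b = (ix a < ix b)%N.
  suff h : lt0 a b <-> (ix a < ix b)%N by apply/idP/idP => /h.
  rewrite -(unroll_lt hu) !eix -(nonneg_unit1 U) mulrSr.
  have e : \1 *+ ix b - \1 *+ ix a - \1 = \1 *+ ix b - (\1 *+ ix a + \1) by zring.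
  by rewrite e; split.
pose th (i : nat) : R := 2 * pi / m%:R * i%:R.
have mR : (0 : R) < m%:R by rewrite ltr0n.
have c0 : (0 : R) < 2 * pi / m%:R by rewrite divr_gt0 // mulr_gt0 ?pi_gt0.
have thD i j : th (i + j)%N = th i + th j by rewrite /th natrD mulrDr.
have thm : th m = 2 * pi by rewrite /th divfK // gt_eqF.
have th_lt i j : (th i < th j) = (i < j)%N by rewrite /th ltr_pM2l // ltr_nat.
have th_range a : 0 <= th (ix a) < 2 * pi.
  by rewrite mulr_ge0 ?ler0n ?(ltW c0) //= -thm th_lt.
pose f a := expi (th (ix a)).
have fD a b : f (a + b) = f a * f b.
  rewrite /f -expiD -thD; have [e|e] := unrollD_or hu a b.
    by congr (expi (th _)); apply: (@unit1_inj U); rewrite -eix e !eix; zring.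
  have -> : (ix a + ix b = ix (a + b)%R + m)%N.
    by apply: (@unit1_inj U); rewrite !mulrnDr -!eix e -zm; zring.
  by rewrite thD thm expiD expi_2pi mulr1.
have f0 : f 0 = 1.
  have fn : f 0 != 0 by rewrite -normr_eq0 norm_expi oner_eq0.
  by apply: (mulfI fn); rewrite -fD addr0 mulr1.
exists [set f a | a in [set: G]]%classic, f; split=> //.
- split.
  + by move=> _ [a _ <-]; apply: norm_expi.
  + by exists 0.
  + by move=> _ _ [a _ <-] [b _ <-]; exists (a + b).
  + move=> _ [a _ <-]; exists (- a) => //.
    have fn : f a != 0 by rewrite -normr_eq0 norm_expi oner_eq0.
    by apply: (mulfI fn); rewrite -fD subrr f0 divff.
- split=> [a|a b _ _ e|y [a _ <-]]; [by exists a| |by exists a].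
  have eth := expi_inj (th_range a) (th_range b) e.
  by have [|//|] := lt0_total a b; rewrite lt0_ix -th_lt eth ltxx.
move=> a b c; rewrite circle_cyc_expi // cyc_lt0P !th_lt !lt0_ix.
by split=> -[/andP|/andP|/andP] h; [apply: Or31|apply: Or32|apply: Or33|
  apply: Or31|apply: Or32|apply: Or33].
Qed.

Lemma winding_infinite_of : ~ c_archimedean R G -> forall n, P (z - \1 *+ n).
Proof.
move=> narch n; have [//|h] := nonneg_total (z - \1 *+ n); case: narch.
have [||i _ e] := @dog_interval U z n; last exact: finite_c_archimedean e.
- exact: ler01.
- by apply: nonneg_eq (nonnegD h (nonneg1 U)) _; zring.
Qed.

End FiniteWinding.

(** * Elementary equivalence *)

Lemma eq_sat (G : cycGroup) f (e e' : nat -> G) :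
  (forall i, i \in fv f -> e i = e' i) -> sat e f <-> sat e' f.
Proof.
have eqe t (d d' : nat -> G) :
    (forall i, i \in term_fv t -> d i = d' i) -> eval d t = eval d' t.
  elim: t => [i|//|t IHt u IHu|t IHt] /= h.
  - by apply: h; rewrite mem_head.
  - by rewrite IHt ?IHu // => i it; apply: h; rewrite mem_cat it ?orbT.
  - by rewrite IHt.
elim: f e e' => [t u|t u v|f IH|f IHf g IHg|j f IH] e e' h /=.
- by rewrite !(eqe _ e e') // => i it; apply: h; rewrite mem_cat it ?orbT.
- by rewrite !(eqe _ e e') // => i it; apply: h; rewrite !mem_cat it ?orbT.
- by have [h1 h2] := IH _ _ h; split=> nf; [move/h2|move/h1].
- have [|h1 h2] := IHf e e'; first by move=> i it; apply: h; rewrite mem_cat it.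
  have [|h3 h4] := IHg e e'; first by move=> i it; apply: h; rewrite mem_cat it orbT.
  by split=> -[hf hg]; split; auto.
- have E a : sat (update e j a) f <-> sat (update e' j a) f.
    apply: IH => i fi; rewrite /update; case: eqP => // /eqP ij.
    by apply: h; rewrite mem_filter ij.
  by split=> -[a /E]; exists a.
Qed.

Lemma models_sentence (G : cycGroup) f (e : nat -> G) :
  sentence f -> models G f <-> sat e f.
Proof.
move=> sf; split=> [|h e']; first exact.
by apply/(eq_sat (e' := e)) => // i; rewrite sf.
Qed.

Fixpoint term_bound (t : term) : nat :=
  match t with
  | Var i => i.+1
  | Zero => 0
  | Add t u => maxn (term_bound t) (term_bound u)
  | Opp t => term_bound t
  end.

(** Bound variables count too, since a quantifier updates a coordinate of a tuple of fixed
    length. *)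
Fixpoint var_bound (f : formula) : nat :=
  match f with
  | Eq t u => maxn (term_bound t) (term_bound u)
  | Cyc t u v => maxn (term_bound t) (maxn (term_bound u) (term_bound v))
  | Not f => var_bound f
  | And f g => maxn (var_bound f) (var_bound g)
  | Exists i f => maxn i.+1 (var_bound f)
  end.

(** Bounds the coefficients of the form representing t: each addition or opposite may bring in one
    more z. *)
Fixpoint term_size (t : term) : nat :=
  match t with
  | Var _ => 1
  | Zero => 0
  | Add t u => (term_size t + term_size u).+1
  | Opp t => (term_size t).+1
  end.

(** * Terms as linear forms in the variables, 1 and z *)

Section Environment.
Variables (k : nat) (G : cycGroup) (u : G) (hu : is_one u).
Local Notation U := (unwound_dogroup hu).
Local Notation z := (winding hu).

Definition env_tuple (e : nat -> G) (i : bool + 'I_k) : U :=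
  match i with
  | inl true => unit1 U
  | inl false => z
  | inr j => unroll hu (e j)
  end.

Lemma env_tuple_update e (j : 'I_k) a :
  env_tuple (update e j a) = set_at (env_tuple e) (inr j) (unroll hu a).
Proof.
apply: funext => -[b|i]; rewrite /env_tuple /set_at /update //.
by rewrite (inj_eq (@inr_inj _ _)) -val_eqE; case: eqP.
Qed.

(** Whether a correction by z occurs is read off the sign of a linear form, which [alike]
    transfers. *)
Lemma unrollD_cases a b (w := unroll hu a + unroll hu b) :
  unroll hu (a + b) = if `[< nonneg (w - z) >] then w - z else w.
Proof.
case: asboolP => h; have [e|e] := unrollD_or hu a b; rewrite ?e //; exfalso.
  by apply: (nonneg_absurd (n := 0) h (unroll_ltz hu (a + b))); rewrite e /w; zring.
by apply: h; rewrite /w -e; apply: unroll_nonneg.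
Qed.

Lemma unrollN_cases a :
  unroll hu (- a) = if `[< nonneg (- unroll hu a) >] then 0 else z - unroll hu a.
Proof.
case: asboolP => h.
  have e := nonneg_anti (unroll_nonneg hu a) h.
  by rewrite -[a](unrollK hu) e oppr0.
have := unrollD_or hu (- a) a; rewrite addNr unroll0 => -[e|e].
  case: h; have -> : - unroll hu a = unroll hu (- a).
    have -> : unroll hu (- a) = unroll hu (- a) + unroll hu a - unroll hu a by zring.
    by rewrite -e; zring.
  exact: unroll_nonneg.
have -> : unroll hu (- a) =
    unroll hu (- a) + unroll hu a - z + (z - unroll hu a) by zring.
by rewrite -e; zring.
Qed.

End Environment.

Section Transfer.
Variables (k : nat) (G H : cycGroup) (u : G) (hu : is_one u) (v : H) (hv : is_one v).
Local Notation U := (unwound_dogroup hu).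
Local Notation V := (unwound_dogroup hv).
Local Notation tupG := (env_tuple (k := k) hu).
Local Notation tupH := (env_tuple (k := k) hv).

(** The same form serves both groups: the case distinctions for sums and opposites are signs of
    forms of bound at most N, on which the tuples agree. *)
Lemma alike_eval N M (e : nat -> G) (e' : nat -> H) t :
  (term_bound t <= k)%N -> (term_size t <= N)%N ->
  alike N M (tupG e) (tupH e') ->
  exists c, [/\ bounded (term_size t) c,
    unroll hu (eval e t) = lform (tupG e) c &
    unroll hv (eval e' t) = lform (tupH e') c].
Proof.
move=> + + hT; pose cz : {ffun bool + 'I_k -> int} := basis_coef (inl false) 1.
have bz : bounded 1 cz by apply: bounded_basis.
have ez : lform (tupG e) cz = winding hu by rewrite lform_basis.
have ez' : lform (tupH e') cz = winding hv by rewrite lform_basis.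
elim: t => [i|_ _|t IHt s IHs|t IHt] /=.
- move=> ik _; exists (basis_coef (inr (Ordinal ik)) 1).
  by rewrite !lform_basis; split=> //; apply: bounded_basis.
- by exists 0; rewrite !lform0; split=> //; apply: bounded0.
- rewrite geq_max => /andP[tk sk] hN.
  have [|c [bc ec ec']] := IHt tk; first by lia.
  have [|d [bd ed ed']] := IHs sk; first by lia.
  have bcd := boundedD bc bd.
  have bcdz : bounded (term_size t + term_size s).+1 (c + d - cz).
    by rewrite -addn1; apply/(boundedD bcd)/boundedN.
  have := proj1 hT _ (boundedW hN bcdz); rewrite !lformB ez ez' !lformD => hs.
  rewrite !unrollD_cases -/(eval _ _) ec ed ec' ed' -(asbool_equiv_eq hs).
  case: ifP => _; [exists (c + d - cz)|exists (c + d)].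
    by rewrite !lformB !lformD ez ez'.
  by rewrite !lformD; split=> //; apply: boundedW bcd.
- move=> tk hN; have [|c [bc ec ec']] := IHt tk; first exact: ltnW.
  have bzc : bounded (term_size t).+1 (cz - c).
    by rewrite -add1n; apply/(boundedD bz)/boundedN.
  have := proj1 hT _ (boundedW (ltnW hN) (boundedN bc)); rewrite !lformN => hs.
  rewrite !unrollN_cases ec ec' -(asbool_equiv_eq hs).
  case: ifP => _; [exists 0|exists (cz - c)].
    by rewrite !lform0; split=> //; apply: bounded0.
  by rewrite !lformB ez ez'.
Qed.

Lemma alike_lt0 N M (e : nat -> G) (e' : nat -> H) s t :
  (term_bound s <= k)%N -> (term_bound t <= k)%N ->
  (term_size s + term_size t <= N)%N ->
  alike N M (tupG e) (tupH e') ->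
  lt0 (eval e s) (eval e t) = lt0 (eval e' s) (eval e' t).
Proof.
move=> sk tk hN hT.
have [|c [bc ec ec']] := alike_eval sk _ hT; first by lia.
have [|d [bd ed ed']] := alike_eval tk _ hT; first by lia.
have := proj1 hT _ (boundedW hN (boundedD bc (boundedN bd))).
rewrite !lformB -ec -ec' -ed -ed'; move: (eval _ s) (eval _ s) (eval _ t) (eval _ t).
move=> {ec ed} a a' {ec' ed'} b b' h.
have L (K : cycGroup) (w : K) (hw : is_one w) (x y : K) :
    lt0 x y = ~~ `[< nonneg (unroll hw x - unroll hw y) >].
  have E : unroll hw y - unroll hw x - unit1 (unwound_dogroup hw) =
    - (unroll hw x - unroll hw y) - unit1 (unwound_dogroup hw) by zring.
  apply/idP/idP => [/(unroll_lt hw)|/asboolPn/nonnegNP]; rewrite ?E.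
    by move=> h1; apply/asboolPn/not_nonneg.
  by rewrite -E => /(unroll_lt hw).
by rewrite (L _ _ hu) (L _ _ hv) (asbool_equiv_eq h).
Qed.

Hypotheses (divU : zgroup U).

(** [alike_set] yields y somewhere in V. The signs of the forms x_j and x_j - z place it in [0, z[,
    so it comes from a point of H. *)
Lemma alike_update N M (e : nat -> G) (e' : nat -> H) (j : 'I_k) a :
  (0 < M)%N -> (0 < N)%N ->
  alike (N + (N * N`! + N * N`! + N`! * M)) (N`! * M)
    (tupG e) (tupH e') ->
  exists b, alike N M (tupG (update e j a))
                        (tupH (update e' j b)).
Proof.
move=> M0 N0 hT.
have [y hy] := alike_set divU (i0 := inl true) erefl erefl M0 hT (inr j) (unroll hu a).
pose cj : {ffun bool + 'I_k -> int} := basis_coef (inr j) 1.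
have bj : bounded N cj by apply: bounded_basis.
exists (roll y); rewrite !env_tuple_update rollK //.
  have := proj1 hy _ bj.
  by rewrite !lform_basis /set_at eqxx => -[+ _]; apply; apply: unroll_nonneg.
apply: (contrapT) => h.
have bz : bounded N (cj - basis_coef (inl false) 1).
  move=> i; rewrite !ffunE; case: eqP => [->|_] /=; first by lia.
  by case: eqP => _; lia.
have := proj1 hy _ bz; rewrite !lformB !lform_basis /set_at eqxx /= !mulr1z => -[_].
have h1 : nonneg (y - winding hv).
  by apply: nonneg_eq (nonnegNP h) _; zring.
move=> /(_ h1) h2; have {}h2 : nonneg (unroll hu a - winding hu) := h2.
by apply: (nonneg_absurd (n := 0) h2 (unroll_ltz hu a)); zring.
Qed.

End Transfer.

(** * Induction on formulas and the initial position *)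

Section Equivalence.
Variables (k : nat) (G H : cycGroup) (u : G) (hu : is_one u) (v : H) (hv : is_one v).
Local Notation U := (unwound_dogroup hu).
Local Notation V := (unwound_dogroup hv).
Local Notation tupG := (env_tuple (k := k) hu).
Local Notation tupH := (env_tuple (k := k) hv).
Hypotheses (divU : zgroup U) (divV : zgroup V).

Lemma alike_sat f : (var_bound f <= k)%N -> exists N M, (0 < M)%N /\
  forall (e : nat -> G) (e' : nat -> H), alike N M (tupG e) (tupH e') ->
  sat e f <-> sat e' f.
Proof.
elim: f => [s t|r s t|f IH|f IHf g IHg|j f IH] /=.
- rewrite geq_max => /andP[sk tk]; exists (term_size s + term_size t)%N, 1%N.
  split=> // e e' hT.
  (* Two terms are equal exactly when [lt0] fails both ways. *)
  have l1 := alike_lt0 sk tk (leqnn _) hT.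
  have l2 : lt0 (eval e t) (eval e s) = lt0 (eval e' t) (eval e' s).
    by apply: alike_lt0 tk sk _ hT; rewrite addnC.
  split=> h.
    by have [|//|] := lt0_total (eval e' s) (eval e' t);
      rewrite -?l1 -?l2 h lt0_irr.
  by have [|//|] := lt0_total (eval e s) (eval e t); rewrite ?l1 ?l2 h lt0_irr.
- rewrite !geq_max => /and3P[rk sk tk].
  exists (term_size r + term_size s + term_size t)%N, 1%N; split=> // e e' hT.
  rewrite !cyc_lt0P (alike_lt0 rk sk _ hT); last by lia.
  rewrite (alike_lt0 sk tk _ hT); last by lia.
  by rewrite (alike_lt0 tk rk _ hT); last by lia.
- by case/IH=> [N [M [M0 h]]]; exists N, M; split=> // e e' /h[h1 h2];
    split=> nf; [move/h2|move/h1].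
- rewrite geq_max => /andP[/IHf[N [M [M0 hf]]] /IHg[N' [M' [M0' hg]]]].
  exists (maxn N N'), (M * M')%N; rewrite muln_gt0 M0; split=> // e e' hT.
  have [f1 f2] := hf _ _ (alikeW (leq_maxl _ _) (dvdn_mulr _ (dvdnn _)) hT).
  have [g1 g2] := hg _ _ (alikeW (leq_maxr _ _) (dvdn_mull _ (dvdnn _)) hT).
  by split=> -[? ?]; split; auto.
- rewrite geq_max => /andP[jk /IH[N [M [M0 h]]]].
  (* [alike_update] wants a positive bound, and N may be 0. *)
  set L := N.+1; exists (L + (L * L`! + L * L`! + L`! * M))%N, (L`! * M)%N.
  split=> [|e e' hT]; first by rewrite muln_gt0 fact_gt0.
  split=> -[a ha].
    have [b hb] := alike_update divU (Ordinal jk) a M0 (ltn0Sn N) hT.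
    by exists b; apply/(h _ _ _).1: ha; apply: alikeW hb.
  have [b hb] := alike_update divV (Ordinal jk) a M0 (ltn0Sn N) (alikeC hT).
  by exists b; apply/(h _ _ _).2: ha; apply/alikeC; apply: alikeW hb.
Qed.

Hypothesis infU : forall n, nonneg (winding hu - unit1 U *+ n).
Hypothesis infV : forall n, nonneg (winding hv - unit1 V *+ n).

(** As z exceeds every multiple of 1, the sign of a + b z is lexicographic and does not depend on
    the group. *)
Lemma nonneg_unit1_winding (K : cycGroup) (w : K) (hw : is_one w)
    (W := unwound_dogroup hw) (a b : int) :
  (forall n, nonneg (winding hw - unit1 W *+ n)) ->
  nonneg (unit1 W *~ a + winding hw *~ b) <-> (0 < b) || (b == 0) && (0 <= a).
Proof.
move=> inf; have z0 : nonneg (winding hw) by apply: ler01.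
have pos c d : 0 < d -> nonneg (unit1 W *~ c + winding hw *~ d).
  case: d => // -[//|d] _; have [a0|a0] := leP 0 c.
    case: c a0 => // c _; exact: nonnegD (nonneg1n _ _) (nonnegMn _ z0).
  case: c a0 => // c _.
  by apply: nonneg_eq (nonnegD (inf c.+1) (nonnegMn d z0)) _; rewrite NegzE; zring.
case: (ltgtP 0 b) => [b0|b0|<-] /=; first by split=> // _; apply: pos.
  split=> // h; have {}h : nonneg (unit1 W *~ a + winding hw *~ b) := h.
  have := pos (- a - 1) (- b); rewrite oppr_gt0 => /(_ b0) h'.
  by exfalso; apply: (nonneg_absurd (n := 0) h h'); zring.
change (nonneg (unit1 W *~ a + winding hw *~ 0) <-> 0 <= a).
have -> : unit1 W *~ a + winding hw *~ 0 = unit1 W *~ a by zring.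
case: a => n; first by split=> // _; apply: nonneg1n.
by split=> // h; case: (nonneg_neg1n (U := W) h).
Qed.

(** With all variables at 0 a form reduces to a + b z, so only the residue of z could distinguish
    the groups. *)
Lemma alike_env0 N M : same_residue M (winding hu) (winding hv) ->
  alike N M (tupG (fun=> 0)) (tupH (fun=> 0)).
Proof.
move=> hz; split=> [c _|[[]|i]]; last exact: same_residue0; last exact: hz;
  last exact: (same_residue_unit1 _ _ _ 1).
have E (K : cycGroup) (w : K) (hw : is_one w) (d : {ffun bool + 'I_k -> int}) :
    lform (env_tuple hw (fun=> 0)) d =
    unit1 (unwound_dogroup hw) *~ d (inl true) + winding hw *~ d (inl false).
  rewrite /lform big_sumType /= big_bool /= [X in _ + X]big1 ?addr0 // => i _.
  by rewrite unroll0 mul0rz.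
by rewrite !E !nonneg_unit1_winding.
Qed.

(** Let z have residues r and r' modulo M. For each prime power N = p^n exactly dividing M, take k0
    congruent to -r modulo N: then N divides z + k0 in U, so D holds in G, hence in H, and N divides
    r' + k0, thus r' - r. *)
Lemma same_residue_winding M : (0 < M)%N ->
  (forall p n k : nat, prime p -> (0 < n)%N -> (k < p ^ n)%N ->
     (models G (D p n k) -> models H (D p n k))) ->
  same_residue M (winding hu) (winding hv).
Proof.
move=> M0 hD; have [q [r er]] := divU (winding hu) M0.
have [q' [r' er']] := divV (winding hv) M0.
suff /dvdnP[t et] : (M %| `|(r' - r)%R|)%N.
  have [s es] : exists s, r' = r + s * M%:Z.
    by have [e|e] : r' - r = t%:Z * M%:Z \/ r' - r = - t%:Z * M%:Z by [lia];
      [exists t%:Z|exists (- t%:Z)]; rewrite -e; lia.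
  exists r; split; first by exists q; rewrite er addrC.
  by exists (q' + unit1 V *~ s); rewrite er' es; zring.
apply/(dvdn_partP _ M0) => p; rewrite mem_primes => /and3P[pp _ pM].
rewrite p_part; set n := logn p M.
have n0 : (0 < n)%N by rewrite logn_gt0 mem_primes pp M0.
have N2 : (2 <= p ^ n)%N.
  apply: leq_trans (prime_gt1 pp) _.
  by rewrite -{1}(expn1 p) leq_exp2l ?prime_gt1.
have /dvdnP[m em] : (p ^ n %| M)%N := pfactor_dvdnn p M.
set N := (p ^ n)%N in N2 em *; have N0 : (0 < N)%N by apply: ltnW.
have [k0 [s [k0N es]]] : exists (k0 : nat) (s : int), (k0 < N)%N /\ r + k0 = s * N.
  exists `|(- r %% N)%Z|%N, (- (- r %/ N)%Z).
  have e := divz_eq (- r) N; have l1 := @modz_ge0 (- r) N.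
  have l2 := @ltz_pmod (- r) N.
  move: (- r %% N)%Z (- r %/ N)%Z l1 l2 e => w t l1 l2 e.
  split; first by lia.
  by rewrite mulNr; lia.
have [q2 eq2] : exists q2 : V, q2 *+ N = winding hv + unit1 V *+ k0.
  apply/(models_D_winding infV N2 k0N)/hD => //.
  apply/(models_D_winding infU N2 k0N); exists (q *+ m + unit1 U *~ s).
  have -> : (q *+ m + unit1 U *~ s) *+ N = q *+ (m * N) + unit1 U *~ (s * N) by zring.
  by rewrite er -es em; zring.
have [s' es'] : exists s' : int, r' + k0 = s' * N.
  apply: (@unit1_dvd V (q2 - q' *+ m) (r' + k0%:Z) N N0).
  have -> : (q2 - q' *+ m) *+ N = q2 *+ N - q' *+ (m * N) by zring.
  by rewrite eq2 er' em; zring.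
have -> : r' - r = (s' - s) * N by rewrite mulrBl -es -es'; ring.
by rewrite abszM absz_nat dvdn_mull.
Qed.

End Equivalence.

Theorem theorem4p23 (R : realType) (G H : cycGroup)
  (discG : discrete G) (discH : discrete H)
  (regG : c_regular G) (regH : c_regular H)
  (narchG : ~ c_archimedean R G) (narchH : ~ c_archimedean R H) :
  elem_equiv G H <->
  (forall p n k : nat, prime p -> (0 < n)%N -> (k < p ^ n)%N ->
     (models G (D p n k) <-> models H (D p n k))).
Proof.
split=> [eqv p n k _ _ _|hD]; first exact/eqv/D_sentence.
have [/(trivial_c_archimedean R)//|[u hu]] := discG.
have [/(trivial_c_archimedean R)//|[v hv]] := discH.
have infU := winding_infinite_of hu narchG.
have infV := winding_infinite_of hv narchH.
have divU := unwound_zgroup infU regG; have divV := unwound_zgroup infV regH.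
move=> f sf; have [N [M [M0 h]]] := alike_sat divU divV (leqnn (var_bound f)).
rewrite (models_sentence (fun=> 0) sf) (models_sentence (G := H) (fun=> 0) sf).
apply: h; apply: alike_env0 => //; apply: same_residue_winding => // p n k pp n0 kn.
by case: (hD p n k pp n0 kn).
Qed.
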